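(* A rational multi-affine matrix-valued function $f(z)=P(z)/q(z)$ belongs to the class $\mathcal{IP}_d^{m\times m}$ if and only if all Wronskians $$W_k[q,P]=q(z)\frac{\partial P}{\partial z_k}(z)-P(z)\frac{\partial q}{\partial z_k}(z),\qquad k=1,\ldots,d,$$ are matrix-valued PSD polynomials.
   Context: Here $z=(z_1,\ldots,z_d)\in\mathbb{C}^d$, and a rational $\mathbb{C}^{m\times m}$-valued function is written as $f(z)=P(z)/q(z)$, where $P$ is a $\mathbb{C}^{m\times m}$-valued polynomial and $q$ is a scalar $\mathbb{C}$-valued polynomial. $\Pi^d=\{z\in\mathbb{C}^d\mid \mathrm{Im}\,z_1>0,\ldots,\mathrm{Im}\,z_d>0\}$. The Pick class $\mathcal{P}_d^{m\times m}$ consists of the $\mathbb{C}^{m\times m}$-valued functions $f$ of $d$ variables holomorphic in $\Pi^d$ with $(f(z)-f(z)^{*})/2i\ge 0$ (positive semidefinite) for $z\in\Pi^d$; $^{*}$ denotes the Hermitian conjugate matrix. $\mathcal{IP}_d^{m\times m}$ is the subclass of rational functions in $\mathcal{P}_d^{m\times m}$ that are Cayley inner, i.e. take Hermitian matrix values almost everywhere on $\mathbb{R}^d$. A rational function $P(z)/q(z)$ is called multi-affine if $\max\{\deg_{z_k}P(z),\deg_{z_k}q(z)\}=1$ for all $k=1,\ldots,d$. A matrix-valued polynomial $F(z)$ is called positive semidefinite (PSD) if its values $F(x)$ are positive semidefinite Hermitian matrices, $F(x)\ge 0$, for every $x\in\mathbb{R}^d$.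
   Formalization: The representation f = P/q is assumed normalised: q is real-valued and P Hermitian-valued on R^d. Without this the claim fails: q = i, P = iz gives f = z in the class but W = -1, and q = 1, P = z + i gives W = 1 but f is not in the class. *)

(* Defs.v *)
From HB Require Import structures.
From mathcomp Require Import all_boot all_order all_algebra.
From mathcomp Require Import spectral complex.
From mathcomp Require Import all_classical all_reals all_analysis.
(* The notations of mpoly clash with those of the analysis library, so that
   [{mpoly C[d]}] has to be written [mpoly d C] below. *)
From mathcomp Require Import -(notations) mpoly.

Set Implicit Arguments.
Unset Strict Implicit.
Unset Printing Implicit Defensive.

Import Order.TTheory GRing.Theory Num.Theory.
Import numFieldNormedType.Exports.

Local Open Scope classical_set_scope.
Local Open Scope ring_scope.

Section Polynomials.
Variables (C : comNzRingType) (d m : nat).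
Implicit Types (q : mpoly d C) (P : 'M[mpoly d C]_m).

Definition peval (z : 'rV[C]_d) (q : mpoly d C) : C :=
  meval (fun k => z ord0 k) q.

Definition mxeval (z : 'rV[C]_d) P : 'M[C]_m := map_mx (peval z) P.

(* The degree in z_k, with the convention that it is 0 for q = 0. *)
Definition degk (k : 'I_d) (q : mpoly d C) : nat :=
  \max_(mon <- msupp q) fun_of_multinom mon k.

Definition mxdegk (k : 'I_d) P : nat :=
  \max_(i < m) \max_(j < m) degk k (P i j).

Definition multi_affine P q : Prop :=
  forall k : 'I_d, maxn (mxdegk k P) (degk k q) = 1%N.

Definition wronskian (k : 'I_d) q P : 'M[mpoly d C]_m :=
  q *: map_mx (mderiv k) P - mderiv k q *: P.

End Polynomials.

Section Matrices.
Variables (C : numClosedFieldType) (m : nat).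
Implicit Types A : 'M[C]_m.
Local Open Scope sesquilinear_scope.

Definition psdmx A : Prop :=
  A \is hermsymmx /\
  forall v : 'cV[C]_m, 0 <= ((v ^t*) *m A *m v) ord0 ord0.

Definition mxIm A : 'M[C]_m := (2 * 'i)^-1 *: (A - A ^t*).

End Matrices.

(* Frechet differentiability over K. It is stated for an abstract K because the
   topology of a numFieldType is not inferred on the constant [complex R]. *)
Definition holomorphic_at (K : numFieldType) (d m : nat)
    (F : 'rV[K]_d -> 'M[K]_m) (z : 'rV[K]_d) : Prop :=
  differentiable F z.

Section RealPoints.
Variables (R : realType) (d m : nat).
Local Notation C := (complex R).

Definition real_point (x : 'rV[R]_d) : 'rV[C]_d := map_mx (real_complex R) x.

(* real_poly q and hermitian_poly P normalise the representation P/q of a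
   rational function Hermitian on R^d. Both matter for the sign of the
   Wronskians: z = (i z)/i has W[i, i z] = -1, and z + i, which is not Hermitian
   on R, has W[1, z + i] = 1. *)
Definition real_poly (q : mpoly d C) : Prop :=
  forall x : 'rV[R]_d, peval (real_point x) q \is Num.real.

Definition hermitian_poly (F : 'M[mpoly d C]_m) : Prop :=
  forall x : 'rV[R]_d, mxeval (real_point x) F \is hermsymmx.

Definition psd_poly (F : 'M[mpoly d C]_m) : Prop :=
  forall x : 'rV[R]_d, psdmx (mxeval (real_point x) F).

(* Lebesgue null sets of R^d (d > 0), the library having no Lebesgue measure
   on 'rV[R]_d: for every e > 0 the set has a countable cover by boxes
   [a n, b n] of total volume at most e. *)
Definition null_set (A : set 'rV[R]_d) : Prop :=
  forall e : R, 0 < e -> exists a b : nat -> 'rV[R]_d,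
    [/\ forall n k, a n ord0 k <= b n ord0 k,
        A `<=` \bigcup_n
          [set x | forall k, a n ord0 k <= x ord0 k <= b n ord0 k] &
        (\sum_(0 <= n <oo) (\prod_k (b n ord0 k - a n ord0 k))%:E <= e%:E)%E].

Definition almost_everywhere (Q : 'rV[R]_d -> Prop) : Prop :=
  null_set [set x | ~ Q x].

End RealPoints.

Section CayleyInner.
Variables (R : realType) (d m : nat).
Local Notation C := (complex R).

Definition upper_polyhalfplane : set 'rV[C]_d :=
  [set z | forall k, 0 < 'Im (z ord0 k)].

(* upper_polyhalfplane is open: the values of F outside of it are irrelevant. *)
Definition pick_class (F : 'rV[C]_d -> 'M[C]_m) : Prop :=
  (forall z, upper_polyhalfplane z -> holomorphic_at F z) /\
  (forall z, upper_polyhalfplane z -> psdmx (mxIm (F z))).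

(* The rational function P/q belongs to the class IP. As P and q may have common
   factors, P/q is identified on upper_polyhalfplane with its holomorphic
   extension F across the removable zeros of q. *)
Definition cayley_inner (P : 'M[mpoly d C]_m) (q : mpoly d C) : Prop :=
  (exists2 F : 'rV[C]_d -> 'M[C]_m, pick_class F &
     forall z, upper_polyhalfplane z -> peval z q != 0 ->
       F z = (peval z q)^-1 *: mxeval z P) /\
  almost_everywhere (fun x : 'rV[R]_d =>
    peval (real_point x) q != 0 /\
    (peval (real_point x) q)^-1 *: mxeval (real_point x) P \is hermsymmx).

End CayleyInner.

(* Main.v *)
Require Import Defs.
From mathcomp Require Import all_boot all_order all_algebra.
From mathcomp Require Import spectral complex polyrcf.
From mathcomp Require Import all_classical all_reals all_analysis.
From mathcomp Require Import -(notations) mpoly.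
From mathcomp Require Import ring lra.

(** For a vector v put p = v^* P v. Both p and q are affine in each variable
    and real on R^d, and where q does not vanish the Hermitian form of Im (P/q) at
    v has the sign of cross (p z) (q z) = Im (p z conj (q z)). Working with this
    polynomial expression avoids dividing by q.

    From P/q in the Pick class to the Wronskians: cross (p z) (q z) >= 0 on the
    open polyhalfplane, hence on its closure, in particular at x + i e_k with x
    real. There p = p(x) + i p_k(x) and q = q(x) + i q_k(x), where p_k and q_k
    are the partial derivatives, and cross is exactly the value of
    W_k = q p_k - p q_k at x ([wronsk_ge0_of_cross_ge0]).

    From the Wronskians to the sign of cross ([increasing_cross_ge0]): variables
    are allowed to leave the real axis one at a time. Fix all variables but z_k
    in the closed half-plane; as a function of z_k, p/q is a Moebius map which
    sends R into the closed upper half-plane. If it took a value P0/Q0 in the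
    lower half-plane at some z_k in the upper one, then h = Q0 p - P0 q, which
    is A + B z_k in the variable z_k, would have its root in the upper
    half-plane. Deform the other variables to real values along a segment: at
    the real end the root lies in the lower half-plane, by the sign of W_k.
    Hence the root crosses the real axis on the way, and at the crossing p and q
    are proportional as functions of z_k, so that W_k vanishes. As W_k has
    finitely many zeros on a complex line, the segment can be chosen to avoid
    them ([segment_avoiding_roots]).

    Zeros of q in the polyhalfplane come from common factors. At such a zero all
    W_k vanish ([wronsk_eq0_at_zero]), because a nonconstant Moebius map is
    open. Some k has, at some zero of q, a nonzero derivative q_k; the zeros of
    q then form a graph over an open set of the other variables, so that
    W_k = 0 identically, P/q does not depend on z_k, and z_k may be replaced by
    a real constant. Finitely many such steps give P'/q' equal to P/q with q'
    zero-free in the polyhalfplane ([cancel_upper_zeros]); it is the holomorphic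
    extension that the definition of the class asks for.

    Almost everywhere on R^d the function is defined and Hermitian, because the
    zeros of q are covered by d sets on which some function affine in each
    variable vanishes with nonzero k-th derivative, and these are countable
    unions of Lipschitz graphs ([null_set_zeros]). *)

Set Implicit Arguments.
Unset Strict Implicit.
Unset Printing Implicit Defensive.

Import Order.TTheory GRing.Theory Num.Theory.
Import numFieldNormedType.Exports.

Local Open Scope classical_set_scope.
Local Open Scope ring_scope.

Local Notation re := complex.Re.
Local Notation im := complex.Im.

(** * Polynomial functions affine in each variable *)

Section PolynomialFunctions.
Variables (K : comNzRingType) (d : nat).
Implicit Types (f g : 'rV[K]_d -> K) (z : 'rV[K]_d) (k : 'I_d).

Definition upd z k (w : K) : 'rV[K]_d :=
  \row_j (if j == k then w else z ord0 j).

(** For a function affine in z_k this is its partial derivative. *)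
Definition slope k f z : K := f (upd z k 1) - f (upd z k 0).

(** Affine in each variable. The formula has base point z, not z_k = 0, because
    it mostly serves to move one coordinate of a given point. *)
Definition maffine f : Prop :=
  forall k z w, f (upd z k w) = f z + (w - z ord0 k) * slope k f z.

Definition wronsk k f g z : K := g z * slope k f z - f z * slope k g z.

(** Polynomial functions are taken as functions rather than as elements of
    [mpoly d K]: substituting a constant for a variable or restricting to a
    line then needs no manipulation of monomials. *)
Inductive polyfun : ('rV[K]_d -> K) -> Prop :=
| polyfun_cst c : polyfun (fun=> c)
| polyfun_coord k : polyfun (fun z => z ord0 k)
| polyfunD f g : polyfun f -> polyfun g -> polyfun (fun z => f z + g z)
| polyfunM f g : polyfun f -> polyfun g -> polyfun (fun z => f z * g z).

Lemma updE z k w j : upd z k w ord0 j = if j == k then w else z ord0 j.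
Proof. by rewrite mxE. Qed.

Lemma upd_id z k : upd z k (z ord0 k) = z.
Proof. by apply/rowP => j; rewrite updE; case: eqP => [->|]. Qed.

Lemma updK z k v w : upd (upd z k v) k w = upd z k w.
Proof. by apply/rowP => j; rewrite !updE; case: eqP. Qed.

Lemma updC z k l v w : k != l ->
  upd (upd z k v) l w = upd (upd z l w) k v.
Proof.
move=> kl; apply/rowP => j; rewrite !updE; case: (eqVneq j l) => // ->.
by rewrite eq_sym (negbTE kl).
Qed.

Lemma slope_upd k f z w : slope k f (upd z k w) = slope k f z.
Proof. by rewrite /slope !updK. Qed.

Lemma wronsk_upd k f g z w : maffine f -> maffine g ->
  wronsk k f g (upd z k w) = wronsk k f g z.
Proof. by move=> mf mg; rewrite /wronsk !slope_upd mf mg; ring. Qed.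

Lemma maffine_upd k w f : maffine f -> maffine (fun z => f (upd z k w)).
Proof.
move=> mf l z v; rewrite /slope; case: (eqVneq l k) => [->|lk].
  by rewrite !updK; ring.
by rewrite !(updC _ _ _ lk) mf updE (negbTE lk).
Qed.

Lemma maffineD f g : maffine f -> maffine g -> maffine (fun z => f z + g z).
Proof. by move=> mf mg k z w; rewrite mf mg /slope; ring. Qed.

Lemma maffineZ c f : maffine f -> maffine (fun z => c * f z).
Proof. by move=> mf k z w; rewrite mf /slope; ring. Qed.

Lemma maffine_cst c : maffine (fun=> c).
Proof. by move=> k z w; rewrite /slope; ring. Qed.

Lemma polyfunB f g : polyfun f -> polyfun g -> polyfun (fun z => f z - g z).
Proof.
move=> pf pg; have -> : (fun z => f z - g z) = (fun z => f z + (-1) * g z).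
  by apply/funext => z; rewrite mulN1r.
by apply: polyfunD => //; apply: polyfunM => //; apply: polyfun_cst.
Qed.

Lemma polyfun_sum (I : Type) (r : seq I) (F : I -> 'rV[K]_d -> K) :
  (forall i, polyfun (F i)) -> polyfun (fun z => \sum_(i <- r) F i z).
Proof.
move=> pF; elim: r => [|i r IH].
  rewrite (_ : (fun z => _) = fun=> 0); first exact: polyfun_cst.
  by apply/funext => z; rewrite big_nil.
rewrite (_ : (fun z => _) = fun z => F i z + \sum_(i <- r) F i z).
  exact: polyfunD.
by apply/funext => z; rewrite big_cons.
Qed.

Lemma maffine_sum (I : eqType) (r : seq I) (F : I -> 'rV[K]_d -> K) :
  (forall i, i \in r -> maffine (F i)) -> maffine (fun z => \sum_(i <- r) F i z).
Proof.
elim: r => [|i r IH] mF.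
  rewrite (_ : (fun z => _) = fun=> 0); first exact: maffine_cst.
  by apply/funext => z; rewrite big_nil.
rewrite (_ : (fun z => _) = fun z => F i z + \sum_(i <- r) F i z).
  apply: maffineD; first by apply: mF; rewrite mem_head.
  by apply: IH => j jr; apply: mF; rewrite inE jr orbT.
by apply/funext => z; rewrite big_cons.
Qed.

Lemma polyfun_prod (I : Type) (r : seq I) (F : I -> 'rV[K]_d -> K) :
  (forall i, polyfun (F i)) -> polyfun (fun z => \prod_(i <- r) F i z).
Proof.
move=> pF; elim: r => [|i r IH].
  rewrite (_ : (fun z => _) = fun=> 1); first exact: polyfun_cst.
  by apply/funext => z; rewrite big_nil.
rewrite (_ : (fun z => _) = fun z => F i z * \prod_(i <- r) F i z).
  exact: polyfunM.
by apply/funext => z; rewrite big_cons.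
Qed.

Lemma polyfunX n f : polyfun f -> polyfun (fun z => f z ^+ n).
Proof.
move=> pf; rewrite (_ : (fun z => _) = fun z => \prod_(i <- iota 0 n) f z).
  exact: polyfun_prod.
by apply/funext => z; rewrite big_const_seq count_predT size_iota iter_mulr_1.
Qed.

Lemma polyfun_upd k w f : polyfun f -> polyfun (fun z => f (upd z k w)).
Proof.
elim=> [c|l|f1 f2 _ p1 _ p2|f1 f2 _ p1 _ p2].
- exact: polyfun_cst.
- rewrite (_ : (fun z => _) = if l == k then fun=> w else fun z => z ord0 l).
    by case: ifP => _; [exact: polyfun_cst|exact: polyfun_coord].
  by apply/funext => z; rewrite updE; case: ifP.
- exact: polyfunD.
- exact: polyfunM.
Qed.

Lemma polyfun_slope k f : polyfun f -> polyfun (slope k f).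
Proof. by move=> pf; apply: polyfunB; apply: polyfun_upd. Qed.

Lemma polyfun_wronsk k f g : polyfun f -> polyfun g -> polyfun (wronsk k f g).
Proof.
by move=> pf pg; apply: polyfunB; apply: polyfunM => //; apply: polyfun_slope.
Qed.

Lemma polyfun_line f (u v : 'rV[K]_d) : polyfun f ->
  exists s : {poly K}, forall t, s.[t] = f (u + t *: v).
Proof.
elim=> [c|l|f1 f2 _ [s1 h1] _ [s2 h2]|f1 f2 _ [s1 h1] _ [s2 h2]].
- by exists c%:P => t; rewrite hornerC.
- by exists ((u ord0 l)%:P + v ord0 l *: 'X) => t; rewrite !hornerE !mxE mulrC.
- by exists (s1 + s2) => t; rewrite hornerD h1 h2.
- by exists (s1 * s2) => t; rewrite hornerM h1 h2.
Qed.

End PolynomialFunctions.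

Section ZeroProduct.
Variables (K : numFieldType) (d : nat).

Lemma poly_eq0_inj (s : {poly K}) (c : nat -> K) : injective c ->
  (forall n, s.[c n] = 0) -> s = 0.
Proof.
move=> inj_c s0; apply/eqP; apply: contraT => sn0.
have := @max_poly_roots _ s [seq c i | i <- iota 0 (size s)] sn0.
rewrite size_map size_iota ltnn; apply.
  by apply/allP => _ /mapP[i _ ->]; apply/eqP/s0.
by rewrite map_inj_uniq ?iota_uniq.
Qed.

(** The ring of polynomial functions is a domain: on the line through a point
    where f is nonzero and one where g is nonzero, a product of two nonzero
    polynomials in one variable would vanish. *)
Lemma polyfun_mul_eq0 (f g : 'rV[K]_d -> K) : polyfun f -> polyfun g ->
  (forall z, f z * g z = 0) -> (exists z, f z != 0) -> forall z, g z = 0.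
Proof.
move=> pf pg fg0 [w fw] z; apply/eqP; apply: contraT => gz.
have [s hs] := polyfun_line w (z - w) pf.
have [t ht] := polyfun_line w (z - w) pg.
have : s * t == 0.
  apply/eqP/(@poly_eq0_inj _ (fun n => n%:R)) => [|n].
    exact: mulrIn (oner_neq0 _).
  by rewrite hornerM hs ht.
rewrite mulf_eq0 => /orP[] /eqP e.
  by have := hs 0; rewrite e horner0 scale0r addr0 => fw0; rewrite -fw0 eqxx in fw.
have := ht 1; rewrite e horner0 scale1r addrC subrK => gz0.
by rewrite -gz0 eqxx in gz.
Qed.

End ZeroProduct.

(** * The sign of Im (a conj b) *)

Section Cross.
Variable R : rcfType.
Local Notation C := (complex R).
Implicit Types a b c e u v : C.

(** Im (a conj b), which has the sign of Im (a / b) when b is nonzero. *)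
Definition cross a b : R := im a * re b - re a * im b.

Lemma reD a b : re (a + b) = re a + re b.
Proof. by case: a b => [? ?] [? ?]. Qed.
Lemma imD a b : im (a + b) = im a + im b.
Proof. by case: a b => [? ?] [? ?]. Qed.
Lemma reM a b : re (a * b) = re a * re b - im a * im b.
Proof. by case: a b => [? ?] [? ?]. Qed.
Lemma imM a b : im (a * b) = re a * im b + im a * re b.
Proof. by case: a b => [? ?] [? ?]. Qed.
Lemma reN a : re (- a) = - re a. Proof. by case: a. Qed.
Lemma imN a : im (- a) = - im a. Proof. by case: a. Qed.
Definition reimE := (reD, imD, reM, imM, reN, imN).

Lemma reim_eq0 a : re a = 0 -> im a = 0 -> a = 0.
Proof. by case: a => [? ?] /= -> ->. Qed.

Lemma crossMl c a b :
  cross (c * a) (c * b) = (re c ^+ 2 + im c ^+ 2) * cross a b.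
Proof. by rewrite /cross !reimE; ring. Qed.

Lemma normsq_ge0 c : 0 <= re c ^+ 2 + im c ^+ 2.
Proof. by rewrite addr_ge0 ?sqr_ge0. Qed.

Lemma normsq_gt0 c : c != 0 -> 0 < re c ^+ 2 + im c ^+ 2.
Proof.
move=> c0; rewrite lt_neqAle addr_ge0 ?sqr_ge0// andbT eq_sym.
apply: contra c0; rewrite paddr_eq0 ?sqr_ge0// !sqrf_eq0.
by move=> /andP[/eqP h /eqP h']; rewrite (reim_eq0 h h').
Qed.

(** Proportional to (P0, Q0), the pair (a, c) represents the same quotient if it
    is nonzero, and then cross has the same strict sign on both. *)
Lemma cross_proportional (P0 Q0 a c : C) : cross P0 Q0 < 0 ->
  Q0 * a = P0 * c -> 0 <= cross a c -> a = 0 /\ c = 0.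
Proof.
move=> neg pr ac.
have Q0n : Q0 != 0.
  by apply: contraTneq neg => ->; rewrite /cross /= !mulr0 subrr ltxx.
have c0 : c = 0.
  apply/eqP; apply: contraT => c0.
  have : 0 <= cross (Q0 * a) (Q0 * c).
    by rewrite crossMl mulr_ge0 ?normsq_ge0//.
  rewrite pr (mulrC P0) (mulrC Q0) crossMl leNgt pmulr_rlt0 ?neg//.
  exact: normsq_gt0.
split=> //; move: pr; rewrite c0 mulr0 => /eqP.
by rewrite mulf_eq0 (negbTE Q0n) => /eqP.
Qed.

(** Up to sign, cross a b is the determinant of the real and imaginary parts of
    a and b. *)
Lemma cross_eq0 a b : cross a b = 0 ->
  exists u v : R, ((u != 0) || (v != 0)) /\ u%:C%C * a + v%:C%C * b = 0.
Proof.
move=> ab; have [b0|bn0] := eqVneq b 0.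
  by exists 0, 1; rewrite oner_neq0 orbT b0 !mulr0 mul0r add0r.
exists (re b ^+ 2 + im b ^+ 2), (- (re a * re b + im a * im b)); split.
  by rewrite gt_eqF// normsq_gt0.
move: ab; rewrite /cross => ab; apply: reim_eq0; rewrite !reimE /=.
  transitivity (- im b * (im a * re b - re a * im b)); first by ring.
  by rewrite ab mulr0.
transitivity (re b * (im a * re b - re a * im b)); first by ring.
by rewrite ab mulr0.
Qed.

Lemma quadratic_lead_ge0 (x y w : R) :
  (forall t : R, 0 <= x + t * y + t ^+ 2 * w) -> 0 <= w.
Proof.
move=> h; rewrite leNgt; apply/negP => w0.
pose t := 1 + (`|x| + `|y|) / (- w).
have Nw : 0 < - w by rewrite oppr_gt0.
have t1 : 1 <= t by rewrite lerDl divr_ge0 ?addr_ge0// ltW.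
have tw : t * - w = - w + (`|x| + `|y|) by rewrite mulrDl mul1r divfK// gt_eqF.
have := h t; rewrite leNgt => /negP; apply.
have hx := ler_norm x; have hy := ler_norm y.
have t0 : 0 < t by lra.
have : t * y <= t * `|y| by rewrite ler_pM2l.
have : x <= t * `|x|.
  by rewrite (le_trans hx)// ler_peMl.
have -> : t ^+ 2 * w = - (t * (t * - w)) by ring.
rewrite tw; nra.
Qed.

(** Homogeneous form of nonnegativity along a real line: the combination with
    u = 0 is the point at infinity, where cross is the leading coefficient of a
    nonnegative quadratic polynomial. *)
Lemma cross_pencil_ge0 a b c e :
  (forall t : R, 0 <= cross (a + t%:C%C * b) (c + t%:C%C * e)) ->
  forall u v : R, 0 <= cross (u%:C%C * a + v%:C%C * b) (u%:C%C * c + v%:C%C * e).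
Proof.
move=> h u v; have [->|u0] := eqVneq u 0.
  rewrite !rmorph0 !mul0r !add0r crossMl mulr_ge0 ?normsq_ge0//.
  apply: (@quadratic_lead_ge0 (cross a c) (cross b c + cross a e)) => t.
  move: (h t); rewrite /cross !reimE /= => /le_trans; apply.
  by rewrite le_eqVlt; apply/orP; left; apply/eqP; ring.
have uC : u%:C%C != 0 :> C by rewrite fmorph_eq0.
have -> : u%:C%C * a + v%:C%C * b = u%:C%C * (a + (v / u)%:C%C * b).
  by rewrite rmorphM fmorphV /=; field.
have -> : u%:C%C * c + v%:C%C * e = u%:C%C * (c + (v / u)%:C%C * e).
  by rewrite rmorphM fmorphV /=; field.
by rewrite crossMl mulr_ge0 ?normsq_ge0//.
Qed.

End Cross.

(** * Nonnegative Wronskians on the real points imply the Pick property *)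

Section Increasing.
Variables (R : rcfType) (d : nat).
Local Notation C := (complex R).
Implicit Types (p q f g : 'rV[C]_d -> C) (x y z : 'rV[C]_d).

Definition real_pt z : Prop := forall k, im (z ord0 k) = 0.

Definition real_fun f : Prop := forall x, real_pt x -> im (f x) = 0.

(** On the real points the quotient p/q is real and, away from the zeros of q,
    nondecreasing in each variable. *)
Record increasing p q : Prop := Increasing {
  inc_polyl : polyfun p;
  inc_polyr : polyfun q;
  inc_maffl : maffine p;
  inc_maffr : maffine q;
  inc_reall : real_fun p;
  inc_realr : real_fun q;
  inc_wronsk : forall k x, real_pt x -> 0 <= re (wronsk k p q x) }.

Lemma real_pt_upd k x (w : R) : real_pt x -> real_pt (upd x k w%:C%C).
Proof. by move=> rx j; rewrite updE; case: ifP. Qed.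

Lemma real_fun_slope k f : real_fun f -> real_fun (slope k f).
Proof.
by move=> rf x rx; rewrite /slope reimE imN !rf ?subr0//;
  apply: (real_pt_upd k _ rx).
Qed.

Lemma polyfun_line_reim f (u v : 'rV[C]_d) : polyfun f ->
  exists s1 s2 : {poly R}, forall t : R,
    re (f (u + t%:C%C *: v)) = s1.[t] /\ im (f (u + t%:C%C *: v)) = s2.[t].
Proof.
elim=> [c|l|f1 f2 _ [s1 [s2 h1]] _ [s3 [s4 h2]]
  |f1 f2 _ [s1 [s2 h1]] _ [s3 [s4 h2]]].
- by exists (re c)%:P, (im c)%:P => t; rewrite !hornerC.
- exists ((re (u ord0 l))%:P + re (v ord0 l) *: 'X),
    ((im (u ord0 l))%:P + im (v ord0 l) *: 'X) => t.
  by rewrite !hornerE !mxE !reimE /=; split; ring.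
- exists (s1 + s3), (s2 + s4) => t; rewrite !hornerD !reimE.
  by have [-> ->] := h1 t; have [-> ->] := h2 t.
- exists (s1 * s3 - s2 * s4), (s1 * s4 + s2 * s3) => t; rewrite !hornerE !reimE.
  by have [-> ->] := h1 t; have [-> ->] := h2 t.
Qed.

Lemma polyfun_line_cross f g (u v : 'rV[C]_d) : polyfun f -> polyfun g ->
  exists s : {poly R}, forall t : R,
    s.[t] = cross (f (u + t%:C%C *: v)) (g (u + t%:C%C *: v)).
Proof.
move=> /(polyfun_line_reim u v)[s1 [s2 hf]] /(polyfun_line_reim u v)[s3 [s4 hg]].
exists (s2 * s3 - s1 * s4) => t; rewrite !hornerE /cross.
by have [-> ->] := hf t; have [-> ->] := hg t.
Qed.

(** The points of the segment from r to i have imaginary part t and real part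
    (1 - t) r, so that each root other than i excludes at most one real r. *)
Lemma segment_avoiding_roots (s : {poly C}) : s.['i%C] != 0 ->
  exists r : R, forall t : R, 0 <= t <= 1 ->
    s.[r%:C%C + t%:C%C * ('i%C - r%:C%C)] != 0.
Proof.
move=> si; have s0 : s != 0 by apply: contraNneq si => ->; rewrite horner0.
have [rs srs] := closed_field_poly_normal s.
pose g (w : C) := `|re w / (1 - im w)|.
exists (1 + \sum_(w <- rs) g w) => t /andP[t0 t1].
set r := 1 + _; set w := (X in s.[X]); apply/negP => sw.
have rew : re w = (1 - t) * r by rewrite /w !reimE /=; ring.
have imw : im w = t by rewrite /w !reimE /=; ring.
have [t_eq1|tn1] := eqVneq t 1.
  suff wi : w = 'i%C by rewrite -wi sw in si.
  by case: w rew imw {sw} => a b /= -> ->; rewrite t_eq1 subrr mul0r.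
have w_in : w \in rs.
  move: sw; rewrite srs hornerZ mulf_eq0 lead_coef_eq0 (negbTE s0)/=.
  rewrite -[_ == 0]/(root _ w).
  by rewrite root_prod_XsubC.
have gw : g w = `|r|.
  by rewrite /g rew imw mulrAC divff ?mul1r// subr_eq0 eq_sym.
have : g w <= \sum_(w <- rs) g w.
  by rewrite (big_rem w)//= lerDl sumr_ge0// => i _; exact: normr_ge0.
rewrite gw leNgt => /negP; apply.
apply: lt_le_trans (ler_norm _).
by rewrite /r ltrDr ltr01.
Qed.

(** The Wronskian is the determinant of the coefficients of p and q as affine
    functions of z_k, so that it vanishes with any nontrivial relation between
    these coefficients. *)
Lemma wronsk_proportional p q z k (u v : R) : maffine p -> maffine q ->
    (u != 0) || (v != 0) ->
    u%:C%C * p (upd z k 0) + v%:C%C * slope k p z = 0 ->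
    u%:C%C * q (upd z k 0) + v%:C%C * slope k q z = 0 -> wronsk k p q z = 0.
Proof.
move=> mp mq uv hp hq.
rewrite -(wronsk_upd k z 0 mp mq) /wronsk !slope_upd.
set a := p _ in hp *; set b := slope k p z in hp *.
set c := q _ in hq *; set e := slope k q z in hq *.
case/orP: uv => [u0|v0].
  apply: (@mulfI _ u%:C%C); first by rewrite fmorph_eq0.
  have -> : u%:C%C * (c * b - a * e) = (u%:C%C * c + v%:C%C * e) * b
    - (u%:C%C * a + v%:C%C * b) * e by ring.
  by rewrite hp hq !mul0r subrr mulr0.
apply: (@mulfI _ v%:C%C); first by rewrite fmorph_eq0.
have -> : v%:C%C * (c * b - a * e) = (u%:C%C * a + v%:C%C * b) * c
    - (u%:C%C * c + v%:C%C * e) * a by ring.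
by rewrite hp hq !mul0r subrr mulr0.
Qed.

Lemma cross_eq0_real p q x : increasing p q -> real_pt x ->
  cross (p x) (q x) = 0.
Proof.
by move=> pq rx; rewrite /cross (inc_reall pq)// (inc_realr pq)// mul0r mulr0 subrr.
Qed.

(** The inductive step: nonnegativity of cross at the points whose k-th
    coordinate is real, and whose real coordinates include those of z, gives it
    at z. *)
Lemma cross_ge0_step p q z k : increasing p q ->
    (forall j, 0 <= im (z ord0 j)) ->
    (forall z', (forall j, 0 <= im (z' ord0 j)) -> im (z' ord0 k) = 0 ->
       (forall j, im (z ord0 j) = 0 -> im (z' ord0 j) = 0) ->
       0 <= cross (p z') (q z')) ->
  0 <= cross (p z) (q z).
Proof.
move=> pq z_ge0 IH.
have [pp mp] := (inc_polyl pq, inc_maffl pq).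
have [pq_ mq] := (inc_polyr pq, inc_maffr pq).
rewrite leNgt; apply/negP => neg.
set P0 := p z in neg; set Q0 := q z in neg.
(* Any real combination of the two coefficients of p and q in z_k is, up to a
   real factor, a value at a point with real k-th coordinate or a limit of
   such. *)
have pencil z' : (forall j, 0 <= im (z' ord0 j)) ->
    (forall j, im (z ord0 j) = 0 -> im (z' ord0 j) = 0) ->
    forall u v : R, 0 <= cross (u%:C%C * p (upd z' k 0) + v%:C%C * slope k p z')
                               (u%:C%C * q (upd z' k 0) + v%:C%C * slope k q z').
  move=> z'0 z'z; apply: cross_pencil_ge0 => t.
  have e f : maffine f -> f (upd z' k 0) + t%:C%C * slope k f z' =
      f (upd z' k t%:C%C) by move=> mf; rewrite !mf; ring.
  rewrite !e//; apply: IH => [j||j]; rewrite updE ?eqxx//=.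
    by case: ifP.
  by case: ifP => // _; exact: z'z.
(* If W_k vanishes at z then p/q is constant in z_k, and at real values of z_k
   the sign is already known. *)
have [W0|Wn0] := eqVneq (wronsk k p q z) 0.
  have pr (u v : R) : Q0 * (u%:C%C * p (upd z k 0) + v%:C%C * slope k p z) =
      P0 * (u%:C%C * q (upd z k 0) + v%:C%C * slope k q z).
    apply: subr0_eq.
    transitivity ((v%:C%C - u%:C%C * z ord0 k) * wronsk k p q z).
      by rewrite /wronsk mp mq -/P0 -/Q0; ring.
    by rewrite W0 mulr0.
  have [_ q0] := cross_proportional neg (pr 1 0) (pencil z z_ge0 (fun=> id) 1 0).
  have [_ q1] := cross_proportional neg (pr 0 1) (pencil z z_ge0 (fun=> id) 0 1).
  move: neg; suff -> : Q0 = 0 by rewrite /cross /= !mulr0 subrr ltxx.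
  move: q0 q1; rewrite !rmorph1 !rmorph0 !mul1r !mul0r add0r addr0 => q0 q1.
  by move: q0; rewrite mq q1 mulr0 addr0.
pose x0 : 'rV[C]_d := \row_j (re (z ord0 j))%:C%C.
pose y0 : 'rV[C]_d := \row_j (im (z ord0 j))%:C%C.
have z_x0y0 : z = x0 + 'i%C *: y0.
  apply/rowP => j; rewrite !mxE; case: (z _ _) => a b; apply/eqP.
  by rewrite eq_complex !reimE /=; apply/andP; split; apply/eqP; ring.
have [s hs] := polyfun_line x0 y0 (polyfun_wronsk k pp pq_).
have [r hr] : exists r : R, forall t : R, 0 <= t <= 1 ->
    s.[r%:C%C + t%:C%C * ('i%C - r%:C%C)] != 0.
  by apply: segment_avoiding_roots; rewrite hs -z_x0y0.
(* The segment from the real point x0 + r y0, at t = 0, to z, at t = 1. *)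
pose zt (t : R) := (x0 + r%:C%C *: y0) + t%:C%C *: (('i%C - r%:C%C) *: y0).
have hzt t : zt t = x0 + (r%:C%C + t%:C%C * ('i%C - r%:C%C)) *: y0.
  by rewrite /zt -addrA scalerA -scalerDl.
have imzt t j : im (zt t ord0 j) = t * im (z ord0 j).
  by rewrite hzt !mxE !reimE /=; ring.
pose h z' := Q0 * p z' - P0 * q z'.
have ph : polyfun h.
  by apply: polyfunB; apply: polyfunM => //; exact: polyfun_cst.
have mh : maffine h.
  by move=> l z' w; rewrite /h /slope !mp !mq /slope; ring.
(* As a function of z_k at zt t, h is A + B z_k; where B is nonzero, N t has the
   sign of minus the imaginary part of its root. *)
have [N hN] := polyfun_line_cross (x0 + r%:C%C *: y0) (('i%C - r%:C%C) *: y0)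
  (polyfun_upd k 0 ph) (polyfun_slope k ph).
have {}hN t : N.[t] = cross (h (upd (zt t) k 0)) (slope k h (zt t)) by exact: hN.
have N0 : 0 <= N.[0].
  have rx : real_pt (upd (zt 0) k 0).
    by apply: (real_pt_upd k 0) => j; rewrite imzt mul0r.
  have rz : real_pt (zt 0) by move=> j; rewrite imzt mul0r.
  have := inc_wronsk pq k rx; rewrite hN /wronsk !slope_upd /h.
  have -> : slope k (fun z' => Q0 * p z' - P0 * q z') (zt 0) =
    Q0 * slope k p (zt 0) - P0 * slope k q (zt 0) by rewrite /slope; ring.
  move: (inc_reall pq rx) (inc_realr pq rx).
  move: (real_fun_slope k (inc_reall pq) rz) (real_fun_slope k (inc_realr pq) rz).
  case: (p _) => a a'; case: (q _) => c c' /=.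
  case: (slope k p _) => b b'; case: (slope k q _) => e e' /= -> -> -> ->.
  move=> W_ge0; have : 0 <= - cross P0 Q0 * (c * b - a * e).
    apply: mulr_ge0; first by rewrite oppr_ge0 ltW.
    by move: W_ge0; rewrite !mulr0 !subr0.
  rewrite /cross !reimE /= => /le_trans; apply.
  by rewrite le_eqVlt; apply/orP; left; apply/eqP; ring.
have N1 : N.[1] <= 0.
  have zt1 : zt 1 = z.
    rewrite hzt [RHS]z_x0y0; congr (_ + _ *: _).
    by rewrite rmorph1 mul1r addrC subrK.
  rewrite hN zt1 mh.
  have -> : h z = 0 by rewrite /h -/P0 -/Q0 mulrC subrr.
  have := z_ge0 k; case: (slope k h z) => a b; case: (z ord0 k) => u v /= v0.
  rewrite /cross !reimE /=.
  have := mulr_ge0 v0 (addr_ge0 (sqr_ge0 a) (sqr_ge0 b)); rewrite -oppr_le0.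
  move=> H; apply: (le_trans _ H); rewrite le_eqVlt.
  by apply/orP; left; apply/eqP; ring.
have [t t01 /eqP Nt] : exists2 t : R, 0 <= t <= 1 & N.[t] == 0.
  have := @poly_ivt _ (- N) 0 1; rewrite ler01 !hornerN oppr_le0 oppr_ge0 N0 N1.
  move=> /(_ isT isT)[t t01]; rewrite /root hornerN oppr_eq0 => /eqP Nt.
  by exists t => //; rewrite Nt.
have Wt : wronsk k p q (zt t) != 0 by rewrite hzt -hs hr.
have t0 : 0 <= t by case/andP: t01.
move: Nt; rewrite hN => /cross_eq0[u [v [uv dep]]].
have pr : Q0 * (u%:C%C * p (upd (zt t) k 0) + v%:C%C * slope k p (zt t)) =
      P0 * (u%:C%C * q (upd (zt t) k 0) + v%:C%C * slope k q (zt t)).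
  by apply: subr0_eq; rewrite -[RHS]dep /h /slope; ring.
have [|j zj|p0 q0] := cross_proportional neg pr (pencil (zt t) _ _ u v).
- by move=> j; rewrite imzt mulr_ge0.
- by rewrite imzt zj mulr0.
by rewrite (wronsk_proportional mp mq uv p0 q0) eqxx in Wt.
Qed.

(** Induction on the number of leading coordinates that may be nonreal. *)
Theorem increasing_cross_ge0 p q : increasing p q ->
  forall z, (forall k, 0 <= im (z ord0 k)) -> 0 <= cross (p z) (q z).
Proof.
move=> pq; suff H s : forall z, (forall k, 0 <= im (z ord0 k)) ->
    (forall k : 'I_d, (s <= k)%N -> im (z ord0 k) = 0) ->
    0 <= cross (p z) (q z).
  by move=> z z0; apply: (H d) => // k; rewrite leqNgt ltn_ord.
elim: s => [|s IH] z z0 zs.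
  by rewrite cross_eq0_real// => k; exact: zs.
have [ds|sd] := leqP d s.
  by apply: IH => // k sk; move: (leq_trans ds sk); rewrite leqNgt ltn_ord.
apply: (@cross_ge0_step _ _ _ (Ordinal sd)) => // z' z'0 z's z'z.
apply: IH => // k; rewrite leq_eqVlt => /predU1P[e|]; last by move/zs/z'z.
by rewrite (_ : k = Ordinal sd)//; apply: val_inj.
Qed.

End Increasing.

(** * Hermitian forms of a matrix *)

Section Forms.
Variables (K : numClosedFieldType) (m : nat).
Local Open Scope sesquilinear_scope.
Implicit Types (A B : 'M[K]_m) (u v w : 'cV[K]_m).

Definition form v A : K := (v ^t* *m A *m v) ord0 ord0.

Lemma form_sum v A :
  form v A = \sum_j \sum_i ((v i ord0)^* * v j ord0) * A i j.
Proof.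
rewrite /form mxE; apply: eq_bigr => j _; rewrite mxE mulr_suml.
by apply: eq_bigr => i _; rewrite !mxE mulrAC.
Qed.

Lemma formB v A B : form v (A - B) = form v A - form v B.
Proof. by rewrite /form mulmxBr mulmxBl !mxE. Qed.

Lemma formZ v c A : form v (c *: A) = c * form v A.
Proof. by rewrite /form -scalemxAr -scalemxAl mxE. Qed.

Lemma form_adj v A : form v (A ^t*) = (form v A)^*.
Proof.
rewrite !form_sum rmorph_sum exchange_big /=; apply: eq_bigr => j _.
rewrite rmorph_sum; apply: eq_bigr => i _.
by rewrite !rmorphM /= conjCK !mxE; congr (_ * _); rewrite mulrC.
Qed.

(** Polarization, with the vectors u + c w for c = 1 and c = i. *)
Lemma form_eq0 A : (forall v, form v A = 0) -> A = 0.
Proof.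
move=> A0; pose b u w := (u ^t* *m A *m w) ord0 ord0.
have bD u w c : b (u + c *: w) (u + c *: w)
    = b u u + c * b u w + c^* * b w u + (c^* * c) * b w w.
  have adj : (u + c *: w)^t* = u^t* + c^* *: w^t*.
    by apply/matrixP => i j; rewrite !mxE rmorphD rmorphM.
  rewrite /b adj !mulmxDl !mulmxDr.
  by rewrite -!scalemxAl -!scalemxAr !mxE; ring.
have e c u w : c * b u w + c^* * b w u = 0.
  have := bD u w c.
  have -> : b u u = 0 by exact: A0.
  have -> : b w w = 0 by exact: A0.
  have -> : b (u + c *: w) (u + c *: w) = 0 by exact: A0.
  by rewrite mulr0 addr0 add0r.
have b0 u w : b u w = 0.
  have := e 1 u w; rewrite conjC1 !mul1r => h1.
  have := e 'i u w; rewrite conjCi => hi.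
  have h2 : b u w = b w u.
    by apply: (mulfI (neq0Ci K)); apply: subr0_eq; rewrite -mulNr.
  by move: h1; rewrite -h2 -mulr2n => /eqP; rewrite mulrn_eq0 => /eqP.
apply/matrixP => i j; have := b0 (delta_mx i ord0) (delta_mx j ord0).
rewrite /b -mulmxA (mxE _ _ ord0) (bigD1 i)//= big1 => [|l li].
  rewrite addr0 !mxE !eqxx /= conjC1 mul1r (bigD1 j)//= big1 => [|l lj].
    by rewrite !mxE !eqxx mulr1 addr0.
  by rewrite !mxE (negbTE lj) mulr0.
by rewrite !mxE (negbTE li) conjC0 mul0r.
Qed.

End Forms.

(** * Zeros in the polyhalfplane *)

Section Vanishing.
Variables (R : rcfType) (d : nat).
Local Notation C := (complex R).
Implicit Types (p q f : 'rV[C]_d -> C) (x y z : 'rV[C]_d).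

Lemma poly_pos_near0 (I : Type) (l : seq I) (s : I -> {poly R}) :
  (forall i, 0 < (s i).[0]) ->
  exists2 e : R, 0 < e & forall t, 0 <= t < e -> all (fun i => 0 < (s i).[t]) l.
Proof.
move=> s0; elim: l => [|i l [e e0 he]]; first by exists 1.
have [e' e'0 he'] := poly_cont 0 (s i) (s0 i).
exists (Order.min e e') => [|t /andP[t0]]; first by rewrite lt_min e0.
rewrite lt_min => /andP[te te'] /=; rewrite he ?t0// andbT.
have := he' t; rewrite subr0 ger0_norm// => /(_ te').
by rewrite ltr_norml => /andP[+ _]; rewrite ltrBrDl subrr.
Qed.

(** A polynomial function vanishing on a nonempty open set is zero; the open
    sets that occur are given by finitely many strict polynomial inequalities,
    and on a real line through z0 these persist near z0. *)
Lemma polyfun_open_eq0 (I : finType) (g h : I -> 'rV[C]_d -> C) f z0 :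
    (forall i, polyfun (g i)) -> (forall i, polyfun (h i)) -> polyfun f ->
    (forall i, 0 < cross (g i z0) (h i z0)) ->
    (forall z, (forall i, 0 < cross (g i z) (h i z)) -> f z = 0) ->
  forall z, f z = 0.
Proof.
move=> pg ph pf z0P fP z.
have /choice[s hs] : forall i, exists s : {poly R}, forall t : R,
    s.[t] = cross (g i (z0 + t%:C%C *: (z - z0))) (h i (z0 + t%:C%C *: (z - z0))).
  by move=> i; exact: polyfun_line_cross.
have [|e e0 he] := @poly_pos_near0 I (enum I) s.
  by move=> i; rewrite hs rmorph0 scale0r addr0.
have [F hF] := polyfun_line z0 (z - z0) pf.
suff F0 : F = 0.
  by have := hF 1; rewrite F0 horner0 scale1r addrC subrK.
apply: (@poly_eq0_inj _ _ (fun n => (e / n.+2%:R)%:C%C)) => [|n].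
  move=> n1 n2 /fmorph_inj /(mulfI (lt0r_neq0 e0)) /invr_inj /eqP.
  by rewrite eqr_nat => /eqP[].
rewrite hF; apply: fP => i; rewrite -hs.
have te : 0 <= e / n.+2%:R < e.
  rewrite divr_ge0 ?ler0n ?(ltW e0)//= ltr_pdivrMr ?ltr0n//.
  by rewrite ltr_pMr// ltr1n.
by have /allP := he _ te; apply; rewrite mem_enum.
Qed.

(** The walk from z to w that changes one coordinate at a time. *)
Definition mix (w z : 'rV[C]_d) (s : nat) : 'rV[C]_d :=
  \row_j (if (j < s)%N then w ord0 j else z ord0 j).

Lemma mixS w z (k : 'I_d) : mix w z k.+1 = upd (mix w z k) k (w ord0 k).
Proof.
apply/rowP => j; rewrite !mxE ltnS leq_eqVlt.
by rewrite -val_eqE; case: eqP => [/val_inj ->|].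
Qed.

(** On the walk from z to w there is a first coordinate whose change makes f
    nonzero; there f has a zero at which it depends on that coordinate. *)
Lemma pivot f z w : maffine f -> f z = 0 -> f w != 0 ->
  exists k : 'I_d, f (mix w z k) = 0 /\ slope k f (mix w z k) != 0.
Proof.
move=> mf fz fw.
have : exists2 k : 'I_d, f (mix w z k) = 0 & f (mix w z k.+1) != 0.
  apply: contrapT => H.
  have mix0 s : (s <= d)%N -> f (mix w z s) = 0.
    elim: s => [_|s IH sd].
      by rewrite (_ : mix w z 0 = z)//; apply/rowP => j; rewrite mxE.
    apply/eqP; apply: contraT => fn0; case: H.
    by exists (Ordinal sd) => //; apply: IH; apply: ltnW.
  move: fw; suff <- : mix w z d = w by rewrite mix0 ?eqxx.
  by apply/rowP => j; rewrite mxE ltn_ord.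
move=> [k fk]; rewrite mixS mf fk add0r => fSk; exists k; split=> //.
by apply: contraNneq fSk => ->; rewrite mulr0.
Qed.

Lemma small_scalar (c1 c2 X Y : R) : 0 < c1 -> 0 < c2 ->
  exists2 s : R, 0 < s & 0 <= c1 + s * X /\ s * Y < c2.
Proof.
move=> c10 c20.
exists (Order.min (c1 / (1 + `|X|)) (c2 / (1 + `|Y|))).
  by rewrite lt_min !divr_gt0// ltr_pwDl.
set s := Order.min _ _.
have s0 : 0 < s by rewrite lt_min !divr_gt0// ltr_pwDl.
have s1 : s * (1 + `|X|) <= c1.
  by rewrite -ler_pdivlMr ?ltr_pwDl// ge_min lexx.
have s2 : s * (1 + `|Y|) <= c2.
  by rewrite -ler_pdivlMr ?ltr_pwDl// ge_min lexx orbT.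
have hX : - X <= `|X| by rewrite -normrN ler_norm.
have hY : Y <= `|Y| by exact: ler_norm.
by split; nra.
Qed.

Definition upper z : Prop := forall k, 0 < im (z ord0 k).

(** If q z = 0 but W_k does not vanish at z, then p z and the slope e of q are
    nonzero and p/q has a simple pole in z_k: moving z_k in the direction
    i p(z) / e gives, to first order, the quotient a value in the lower
    half-plane. *)
Lemma wronsk_eq0_at_zero p q z k : increasing p q -> upper z -> q z = 0 ->
  wronsk k p q z = 0.
Proof.
move=> pq uz qz; rewrite /wronsk qz mul0r sub0r.
apply/eqP; rewrite oppr_eq0; apply: contraT; rewrite mulf_eq0 negb_or.
set b := slope k p z; set e := slope k q z => /andP[pz e0].
pose h0 := 'i%C * p z / e.
have h0e : h0 * e = 'i%C * p z by rewrite divfK.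
have c2 := normsq_gt0 pz.
have [s s0 [sX sY]] :=
  small_scalar (im h0) (cross (h0 * b) (h0 * e)) (uz k) c2.
have := @increasing_cross_ge0 _ _ p q pq (upd z k (z ord0 k + s%:C%C * h0)).
rewrite leNgt => /(_ _)/negP; case.
  move=> j; rewrite updE; case: ifP => [_|_]; last exact/ltW.
  suff -> : im (z ord0 k + s%:C%C * h0) = im (z ord0 k) + s * im h0 by [].
  by rewrite imD imM /=; ring.
rewrite (inc_maffl pq) (inc_maffr pq) -/b -/e qz add0r (addrC (z _ _)) addrK.
have -> : cross (p z + s%:C%C * h0 * b) (s%:C%C * h0 * e) =
    s * (cross (p z) (h0 * e) + s * cross (h0 * b) (h0 * e)).
  by rewrite -!mulrA /cross !reimE /=; ring.
rewrite pmulr_rlt0//.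
have -> : cross (p z) (h0 * e) = - (re (p z) ^+ 2 + im (p z) ^+ 2).
  by rewrite h0e /cross !reimE /=; ring.
by rewrite addrC subr_lt0.
Qed.

Lemma increasing_upd p q k (r : R) : increasing p q ->
  increasing (fun z => p (upd z k r%:C%C)) (fun z => q (upd z k r%:C%C)).
Proof.
move=> pq; split.
- exact/polyfun_upd/(inc_polyl pq).
- exact/polyfun_upd/(inc_polyr pq).
- exact/maffine_upd/(inc_maffl pq).
- exact/maffine_upd/(inc_maffr pq).
- by move=> x rx; apply: (inc_reall pq); exact: real_pt_upd.
- by move=> x rx; apply: (inc_realr pq); exact: real_pt_upd.
move=> j x rx; have [->|jk] := eqVneq j k.
  by rewrite /wronsk /slope !updK !subrr !mulr0 subrr.
have := inc_wronsk pq j (real_pt_upd k r rx).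
by rewrite /wronsk /slope !(updC _ _ _ jk).
Qed.

End Vanishing.

(** * Cancelling the zeros in the polyhalfplane *)

Section Reduction.
Variables (R : rcfType) (d m : nat).
Local Notation C := (complex R).
Implicit Types (P : 'rV[C]_d -> 'M[C]_m) (q : 'rV[C]_d -> C) (z : 'rV[C]_d).

Record increasing_mx P q : Prop := IncreasingMx {
  incm_poly : forall i j, polyfun (fun z => P z i j);
  incm_form : forall v, increasing (fun z => form v (P z)) q }.

Lemma increasing_mx_upd P q k (r : R) : increasing_mx P q ->
  increasing_mx (fun z => P (upd z k r%:C%C)) (fun z => q (upd z k r%:C%C)).
Proof.
case=> pP iP; split=> [i j|v]; first exact: (polyfun_upd k _ (pP i j)).
exact: increasing_upd (iP v).
Qed.

(** Around the zero found by [pivot], the equation q = 0 can be solved for z_k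
    while staying in the polyhalfplane, for all values of the other coordinates
    in an open set. There W_k vanishes by [wronsk_eq0_at_zero], hence it
    vanishes identically. *)
Lemma removable_variable P q z0 : increasing_mx P q -> upper z0 -> q z0 = 0 ->
  (exists z, q z != 0) ->
  exists k, (exists z, slope k q z != 0) /\
    forall v z, wronsk k (fun z => form v (P z)) q z = 0.
Proof.
move=> iP uz0 qz0 [w0 qw0].
have [pq mq] := (inc_polyr (incm_form iP 0), inc_maffr (incm_form iP 0)).
have [w uw qw] : exists2 w, upper w & q w != 0.
  apply: contrapT => H; move: qw0; rewrite [q w0]( _ : _ = 0) ?eqxx//.
  apply: (@polyfun_open_eq0 _ _ 'I_d
    (fun k z => z ord0 k) (fun _ _ => 1) q z0) => //.
  - by move=> k; exact: polyfun_coord.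
  - by move=> k; exact: polyfun_cst.
  - by move=> k; rewrite /cross /= mulr1 mulr0 subr0.
  move=> z hz; apply/eqP; apply: contraT => qz; case: H; exists z => // k.
  by have := hz k; rewrite /cross /= mulr1 mulr0 subr0.
have [k [q1 s1]] := pivot mq qz0 qw; set z1 := mix w z0 k in q1 s1.
have uz1 : upper z1 by move=> j; rewrite mxE; case: ifP.
exists k; split=> [|v]; first by exists z1.
have pv := inc_polyl (incm_form iP v).
(* The open set where all coordinates lie in the upper half-plane, and so does
   the root - q (upd z k 0) / slope k q z of q in z_k. *)
pose g (i : option 'I_d) z :=
  if i is Some j then z ord0 j else (-1) * q (upd z k 0).
pose h (i : option 'I_d) z := if i is Some j then 1 else slope k q z.
apply: (@polyfun_open_eq0 _ _ (option 'I_d) g h _ z1).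
- case=> [j|]; first exact: polyfun_coord.
  apply: polyfunM; first exact: polyfun_cst.
  exact: polyfun_upd.
- by case=> [j|]; [exact: polyfun_cst|exact: polyfun_slope].
- exact: polyfun_wronsk.
- case=> [j|]; rewrite /g /h /cross /= ?mulr1 ?mulr0 ?subr0//.
  rewrite mq q1 add0r sub0r mulrA mulN1r opprK.
  have := mulr_gt0 (uz1 k) (normsq_gt0 s1); rewrite !reimE.
  by move/lt_le_trans; apply; rewrite le_eqVlt; apply/orP; left; apply/eqP; ring.
move=> z hz.
have e0 : slope k q z != 0.
  by apply: contraTneq (hz None) => e; rewrite /g /h e /cross /= !mulr0 subrr ltxx.
pose r : C := - q (upd z k 0) / slope k q z.
rewrite -(wronsk_upd k z r (inc_maffl (incm_form iP v)) mq).
apply: (wronsk_eq0_at_zero k (incm_form iP v)).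
  move=> j; rewrite updE; case: ifP => _; last first.
    by have := hz (Some j); rewrite /g /h /cross /= mulr1 mulr0 subr0.
  have := hz None; rewrite /g /h mulN1r.
  have -> : - q (upd z k 0) = slope k q z * r by rewrite mulrC divfK.
  rewrite -{2}[slope k q z]mulr1 crossMl pmulr_rgt0 ?normsq_gt0//.
  by rewrite /cross /= mulr1 mulr0 subr0.
have -> : q (upd z k r) = q (upd z k 0) + r * slope k q z by rewrite !mq; ring.
by rewrite divfK// subrr.
Qed.

(** Replacing one of these variables by a constant removes it from the set and
    adds none, so that the cardinal bounds the number of replacements. *)
Definition active q : {set 'I_d} := [set k | `[< exists z, slope k q z != 0 >]].

(** If W_k = 0 identically then the restriction of (P, q) to z_k = r represents
    the same quotient, as soon as r is chosen so that q does not vanish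
    identically on z_k = r. *)
Theorem cancel_upper_zeros P q : increasing_mx P q -> (exists z, q z != 0) ->
  exists P' q', [/\ increasing_mx P' q',
    forall z, q z *: P' z = q' z *: P z & forall z, upper z -> q' z != 0].
Proof.
have [n] := ubnP #|active q|; elim: n P q => // n IH P q.
rewrite ltnS => act iP qn0.
have [[z0 uz0 qz0]|H] := pselect (exists2 z, upper z & q z = 0); last first.
  by exists P, q; split=> // z uz; apply/eqP => qz; apply: H; exists z.
have [k [[z1 s1] Wk]] := removable_variable iP uz0 qz0 qn0.
have mq := inc_maffr (incm_form iP 0).
have [r qr] : exists r : R, q (upd z1 k r%:C%C) != 0.
  have [q0|q0] := eqVneq (q (upd z1 k 0)) 0; last by exists 0.
  by exists 1; move: s1; rewrite /slope q0 subr0.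
pose P1 z := P (upd z k r%:C%C); pose q1 z := q (upd z k r%:C%C).
have iP1 : increasing_mx P1 q1 by exact: increasing_mx_upd.
have act1 : (#|active q1| < n)%N.
  apply: leq_trans act; apply/proper_card/properP; split.
    apply/fintype.subsetP => j; rewrite !finset.in_set => /asboolP[z].
    rewrite /slope /q1; have [->|jk] := eqVneq j k;
      first by rewrite !updK subrr eqxx.
    by rewrite !(updC _ _ _ jk) => sz; apply/asboolP; exists (upd z k r%:C%C).
  exists k; rewrite finset.in_set; first by apply/asboolP; exists z1.
  by apply/asboolP => -[z]; rewrite /slope /q1 !updK subrr eqxx.
have [|P2 [q2 [iP2 rel2 q2n0]]] := IH P1 q1 act1 iP1; first by exists z1.
exists P2, q2; split=> // z.
have rel1 z' : q z' *: P1 z' = q1 z' *: P z'.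
  apply: subr0_eq; apply: form_eq0 => v; rewrite formB !formZ.
  have := inc_maffl (incm_form iP v) k z' r%:C%C.
  rewrite /P1 /q1 => ->; rewrite mq.
  transitivity ((r%:C%C - z' ord0 k) * wronsk k (fun z => form v (P z)) q z').
    by rewrite /wronsk; ring.
  by rewrite Wk mulr0.
apply/matrixP => i j; apply: subr0_eq; rewrite !mxE.
(* Both relations to the intermediate pair combine after cancelling q1. *)
have pq1 := inc_polyr (incm_form iP1 0).
apply: (@polyfun_mul_eq0 _ _ q1 (fun z => q z * P2 z i j - q2 z * P z i j)) => //.
- apply: polyfunB; apply: polyfunM.
  + exact: (inc_polyr (incm_form iP 0)).
  + exact: (incm_poly iP2).
  + exact: (inc_polyr (incm_form iP2 0)).
  + exact: (incm_poly iP).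
- move=> z'; have /matrixP/(_ i j) := rel2 z'; have /matrixP/(_ i j) := rel1 z'.
  rewrite !mxE => e1 e2.
  transitivity (q z' * (q1 z' * P2 z' i j) - q2 z' * (q1 z' * P z' i j)).
    by ring.
  by rewrite e2 -e1; ring.
by exists z1.
Qed.

End Reduction.

(** * Null sets *)

Section NullSets.
Variables (R : realType) (d : nat).
Implicit Types (A B : set 'rV[R]_d) (x y : 'rV[R]_d).

Definition box (a b : 'rV[R]_d) : set 'rV[R]_d :=
  [set x | forall k, a ord0 k <= x ord0 k <= b ord0 k].

Definition vol (a b : 'rV[R]_d) : R := \prod_k (b ord0 k - a ord0 k).

Lemma vol_ge0 (a b : 'rV[R]_d) : (forall k, a ord0 k <= b ord0 k) -> 0 <= vol a b.
Proof. by move=> ab; apply: prodr_ge0 => k _; rewrite subr_ge0. Qed.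

Lemma null_set_subset A B : A `<=` B -> Defs.null_set B -> Defs.null_set A.
Proof.
move=> AB B0 e e0; have [a [b [ab Bab sab]]] := B0 e e0.
by exists a, b; split=> //; apply: subset_trans Bab.
Qed.

(** Indexing covers by any countable type makes room for pairs of indices and
    for the cells of a finite grid; unused integers receive the degenerate box
    at the origin, whose volume is zero in positive dimension. *)
Lemma null_set_countable_cover A : (0 < d)%N ->
  (forall e : R, 0 < e -> exists (I : countType) (a b : I -> 'rV[R]_d),
     [/\ forall i k, a i ord0 k <= b i ord0 k,
         A `<=` \bigcup_i box (a i) (b i) &
         (\esum_(i in [set: I]) (vol (a i) (b i))%:E <= e%:E)%E]) ->
  Defs.null_set A.
Proof.
move=> d_gt0 H e /H[I [a [b [ab Aab sab]]]].
pose a' n := if @pickle_inv I n is Some i then a i else 0.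
pose b' n := if @pickle_inv I n is Some i then b i else 0.
have ab' n k : a' n ord0 k <= b' n ord0 k.
  by rewrite /a' /b'; case: pickle_inv.
exists a', b'; split=> //.
  by move=> x /Aab[i _ xi]; exists (pickle i) => //; rewrite /a' /b' pickleK_inv.
apply: le_trans sab;
  rewrite -[X in (X <= _)%E]/(\sum_(n <oo) (vol (a' n) (b' n))%:E)%E.
rewrite nneseries_esumT; last by move=> n; rewrite lee_fin vol_ge0.
have -> : (\esum_(n in [set: nat]) (vol (a' n) (b' n))%:E =
    \esum_(n in [set (pickle i : nat) | i in [set: I]]) (vol (a' n) (b' n))%:E)%E.
  rewrite [RHS]esum_mkcond; apply: eq_esum => n _; case: ifPn => // /negP nI.
  rewrite /a' /b'; case E : (@pickle_inv I n) => [i|].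
    exfalso; apply: nI; rewrite inE; exists i => //.
    by have := @pickle_invK I n; rewrite /= E.
  by rewrite /vol (bigD1 (Ordinal d_gt0))//= mxE subrr mul0r.
rewrite esum_image.
  by rewrite le_eqVlt; apply/orP; left; apply/eqP/eq_esum => i _;
    rewrite /a' /b' pickleK_inv.
by move=> i j _ _; exact: (pcan_inj pickleK).
Qed.

Lemma null_set_bigcup (A : nat -> set 'rV[R]_d) : (0 < d)%N ->
  (forall n, Defs.null_set (A n)) -> Defs.null_set (\bigcup_n A n).
Proof.
move=> d_gt0 A0; apply: null_set_countable_cover => // e e0.
have /choice[ab hab] : forall n, exists ab : (nat -> 'rV[R]_d) * (nat -> 'rV[R]_d),
    [/\ forall i k, ab.1 i ord0 k <= ab.2 i ord0 k,
        A n `<=` \bigcup_i box (ab.1 i) (ab.2 i) &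
        (\sum_(i <oo) (vol (ab.1 i) (ab.2 i))%:E <= (e / (2 ^ n.+1)%:R)%:E)%E].
  move=> n; have [|a [b hab]] := A0 n (e / (2 ^ n.+1)%:R).
    by rewrite divr_gt0// ltr0n expn_gt0.
  by exists (a, b).
pose a (i : nat * nat) := (ab i.1).1 i.2; pose b (i : nat * nat) := (ab i.1).2 i.2.
exists (nat * nat)%type, a, b; split.
- by move=> i k; have [+ _ _] := hab i.1; exact.
- move=> x [n _ Ax]; have [_ + _] := hab n => /(_ _ Ax)[i _ xi].
  by exists (n, i).
have -> : [set: nat * nat] = [set: nat] `*`` (fun=> [set: nat]).
  by apply/seteqP; split.
rewrite -(@esum_esum _ _ _ [set: nat] (fun=> [set: nat])
  (fun i j => (vol ((ab i).1 j) ((ab i).2 j))%:E)); last first.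
  by move=> i j _ _; rewrite lee_fin vol_ge0// => k; have [+ _ _] := hab i; exact.
have h n : (\esum_(j in [set: nat]) (vol ((ab n).1 j) ((ab n).2 j))%:E <=
            (e / (2 ^ n.+1)%:R)%:E)%E.
  have [h1 _ h2] := hab n; rewrite -nneseries_esumT//.
  by move=> j; rewrite lee_fin vol_ge0.
apply: le_trans (epsilon_trick0 xpredT (ltW e0)).
rewrite nneseries_esumT; first by apply: le_esum => n _; exact: h.
by move=> n; rewrite lee_fin divr_ge0 ?(ltW e0).
Qed.

Lemma grid_cell (N : nat) (h t : R) : 0 <= t <= N.+1%:R * h ->
  exists i : 'I_N.+1, i%:R * h <= t <= i.+1%:R * h.
Proof.
elim: N => [|N IH] /andP[t0 tN]; first by exists ord0; rewrite mul0r t0.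
have [tN'|tN'] := leP t (N.+1%:R * h).
  have [|i hi] := IH; first by rewrite t0.
  by exists (widen_ord (leqnSn _) i).
by exists ord_max; rewrite (ltW tN').
Qed.

(** Divide [-M, M] in N + 1 intervals of length h in each direction other than
    k. Over each of the cells so obtained the graph has height at most 2 K h, so
    that the boxes over all cells have total volume of order h. *)
Lemma null_set_lipschitz_graph A (k : 'I_d) (M K : R) : 0 < M -> 0 <= K ->
  (forall x, A x -> forall j, `|x ord0 j| <= M) ->
  (forall x y (r : R), A x -> A y -> 0 <= r ->
     (forall j, j != k -> `|x ord0 j - y ord0 j| <= r) ->
     `|x ord0 k - y ord0 k| <= K * r) ->
  Defs.null_set A.
Proof.
move=> M0 K0 AM AK; apply: null_set_countable_cover => [|e e0].
  exact: leq_ltn_trans (ltn_ord k).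
pose V : R := \prod_(j < d | j != k) (2 * M).
have V0 : 0 <= V by apply: prodr_ge0 => j _; rewrite mulr_ge0// ltW.
have [N hN] : exists N : nat, 2 * K * (2 * M) * V / e <= N.+1%:R.
  exists (Num.bound (2 * K * (2 * M) * V / e)).
  apply: (@le_trans _ _ (Num.bound (2 * K * (2 * M) * V / e))%:R); last first.
    by rewrite ler_nat.
  by apply/ltW/archi_boundP; rewrite divr_ge0 ?(ltW e0)// !mulr_ge0// ltW.
pose h : R := 2 * M / N.+1%:R.
have h0 : 0 < h by rewrite divr_gt0 ?ltr0n// mulr_gt0.
have Nh : N.+1%:R * h = 2 * M by rewrite mulrC divfK// pnatr_eq0.
pose I := {ffun 'I_d -> 'I_N.+1}.
pose cell (s : I) x := forall j, j != k ->
  - M + (s j)%:R * h <= x ord0 j <= - M + (s j).+1%:R * h.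
have /choice[c hc] : forall s : I, exists c : R,
    forall x, A x -> cell s x -> `|x ord0 k - c| <= K * h.
  move=> s; have [[y Ay cy]|no] := pselect (exists2 y, A y & cell s y); last first.
    by exists 0 => x Ax cx; case: no; exists x.
  exists (y ord0 k) => x Ax cx; apply: AK => // [|j jk]; first exact: ltW.
  have /andP[x1 x2] := cx j jk; have /andP[y1 y2] := cy j jk.
  rewrite ler_norml; rewrite -!natr1 in x2 y2; apply/andP; split; lra.
(* Cells are indexed by all s : I; to count each cell of the other directions
   once, the boxes with s k != 0 are made degenerate. The total volume is then
   a sum over I of products of widths, which factorizes. *)
pose a (s : I) : 'rV[R]_d := \row_j (if j == k then
   if s k == ord0 then c s - K * h else 0 else - M + (s j)%:R * h).
pose b (s : I) : 'rV[R]_d := \row_j (if j == k then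
   if s k == ord0 then c s + K * h else 0 else - M + (s j).+1%:R * h).
pose w (j : 'I_d) (i : 'I_N.+1) : R :=
  if j == k then if i == ord0 then 2 * K * h else 0 else h.
have wE s j : b s ord0 j - a s ord0 j = w j (s j).
  rewrite !mxE /w; case: (eqVneq j k) => [->|jk].
    by case: ifP => _; ring.
  by rewrite -natr1; ring.
exists I, a, b; split.
- move=> s j; rewrite -subr_ge0 wE /w; case: ifP => _; last exact: ltW.
  by case: ifP => // _; rewrite !mulr_ge0// ltW.
- move=> x Ax.
  have /choice[s hs] : forall j, exists i : 'I_N.+1,
      (j != k -> - M + i%:R * h <= x ord0 j <= - M + i.+1%:R * h) /\
      (j = k -> i = ord0).
    move=> j; have [->|jk] := eqVneq j k; first by exists ord0.
    have := AM x Ax j; rewrite ler_norml => /andP[x1 x2].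
    have [|i /andP[i1 i2]] := @grid_cell N h (x ord0 j + M).
      by rewrite Nh; apply/andP; split; lra.
    exists i; split=> [_|e1]; first by apply/andP; split; lra.
    by rewrite e1 eqxx in jk.
  have cx : cell [ffun j => s j] x by move=> j jk; rewrite ffunE; apply: (hs j).1.
  exists [ffun j => s j] => // j; rewrite !mxE; case: (eqVneq j k) => [->|jk].
    rewrite ffunE ((hs k).2 erefl) eqxx.
    have := hc _ x Ax cx; rewrite ler_norml => /andP[c1 c2].
    by apply/andP; split; lra.
  exact: cx.
rewrite (_ : [set: I] = [set` enum I]); last first.
  by apply/seteqP; split=> s //= _; rewrite mem_enum.
rewrite esum_fset; last 2 first.
- exact: finite_seq.
- move=> s _; rewrite lee_fin; apply: prodr_ge0 => j _; rewrite wE /w.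
  case: ifP => _; last exact: ltW.
  by case: ifP => // _; rewrite !mulr_ge0// ltW.
rewrite -fsbig_seq ?enum_uniq// sumEFin lee_fin big_enum/=.
under eq_bigr do (rewrite /vol; under eq_bigr do rewrite wE).
rewrite -(bigA_distr_bigA w) (bigD1 k)//=.
have -> : \sum_j w k j = 2 * K * h.
  rewrite (bigD1 ord0)//= /w !eqxx big1 ?addr0// => j /negbTE ->.
  by [].
rewrite (_ : \prod_(_ | _) _ = V); last first.
  apply: eq_bigr => j jk; rewrite -Nh /w (negbTE jk) sumr_const card_ord.
  by rewrite mulr_natl.
rewrite ler_pdivrMr// in hN.
rewrite /h -(ler_pM2l (ltr0Sn R N)).
apply: le_trans hN; rewrite le_eqVlt; apply/orP; left; apply/eqP.
have : N.+1%:R != 0 :> R by rewrite pnatr_eq0.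
by move: N.+1%:R => X X0; field.
Qed.

End NullSets.

(** * Real zeros of a function affine in each variable *)

Section ZeroSets.

Lemma polyfun_lipschitz (K : numDomainType) (d : nat) (f : 'rV[K]_d -> K) (M : K) :
  0 <= M -> polyfun f -> exists B L : K, [/\ 0 <= B, 0 <= L,
    forall x : 'rV[K]_d, (forall j, `|x ord0 j| <= M) -> `|f x| <= B &
    forall (x y : 'rV[K]_d) (r : K), (forall j, `|x ord0 j| <= M) ->
      (forall j, `|y ord0 j| <= M) ->
      (forall j, `|x ord0 j - y ord0 j| <= r) -> `|f x - f y| <= L * r].
Proof.
move=> M0; elim=> [c|k|f1 f2 _ [B1 [L1 [B10 L10 b1 l1]]] _ [B2 [L2 [B20 L20 b2 l2]]]
  |f1 f2 _ [B1 [L1 [B10 L10 b1 l1]]] _ [B2 [L2 [B20 L20 b2 l2]]]].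
- by exists `|c|, 0; split=> // x y r _ _ _; rewrite subrr normr0 mul0r.
- by exists M, 1; split=> // x y r _ _ h; rewrite mul1r.
- exists (B1 + B2), (L1 + L2); split; rewrite ?addr_ge0//.
    move=> x hx.
    by rewrite (le_trans (ler_normD _ _))// lerD ?b1 ?b2.
  move=> x y r hx hy hr.
  rewrite opprD addrACA (le_trans (ler_normD _ _))// mulrDl.
  by rewrite lerD ?l1 ?l2.
exists (B1 * B2), (L1 * B2 + B1 * L2); split.
- exact: mulr_ge0.
- by rewrite addr_ge0 ?mulr_ge0.
- by move=> x hx; rewrite normrM ler_pM ?b1 ?b2.
move=> x y r hx hy hr.
have -> : f1 x * f2 x - f1 y * f2 y = (f1 x - f1 y) * f2 x + f1 y * (f2 x - f2 y).
  by ring.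
rewrite (le_trans (ler_normD _ _))// !normrM mulrDl mulrAC -mulrA lerD//.
  by rewrite mulrA ler_pM ?b2// l1.
by rewrite -mulrA ler_pM ?b1// l2.
Qed.

Variables (R : realType) (d : nat).
Local Notation C := (complex R).

Lemma norm_real_complex (a : R) : `|a%:C%C| = `|a|%:C%C :> C.
Proof. by rewrite normc_def /= expr0n /= addr0 sqrtr_sqr. Qed.

Lemma norm_complex_real (a : C) : exists2 r : R, 0 <= r & `|a| = r%:C%C.
Proof. by rewrite normc_def; eexists; [|reflexivity]; exact: sqrtr_ge0. Qed.

(** Where |x_j| <= n + 1 and the slope of g is at least 1 / (n + 1) in absolute
    value, the equation g = 0 determines x_k as a Lipschitz function of the
    other coordinates. *)
Lemma null_set_graph (g : 'rV[C]_d -> C) (k : 'I_d) : polyfun g -> maffine g ->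
  Defs.null_set [set x : 'rV[R]_d |
    g (real_point x) = 0 /\ slope k g (real_point x) != 0].
Proof.
move=> pg mg; have d_gt0 : (0 < d)%N by exact: leq_ltn_trans (ltn_ord k).
pose A (n : nat) := [set x : 'rV[R]_d | [/\ forall j, `|x ord0 j| <= n.+1%:R,
  g (real_point x) = 0 & n.+1%:R^-1 <= `|slope k g (real_point x)| ]].
apply: (@null_set_subset _ _ _ (\bigcup_n A n)).
  move=> x [gx sx]; have [r _ rE] := norm_complex_real (slope k g (real_point x)).
  have r0 : 0 < r by rewrite -ltcR -rE normr_gt0.
  pose S := \sum_j `|x ord0 j| + r^-1.
  have jS j : `|x ord0 j| <= S.
    rewrite /S (bigD1 j)//= -addrA lerDl addr_ge0 ?invr_ge0 ?(ltW r0)//.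
    by apply: sumr_ge0.
  have rS : r^-1 <= S by rewrite lerDr sumr_ge0.
  have Sn : S <= (Num.bound S).+1%:R.
    apply: (@le_trans _ _ (Num.bound S)%:R); last by rewrite ler_nat.
    by apply/ltW/archi_boundP; apply: (le_trans _ rS); rewrite invr_ge0 ltW.
  exists (Num.bound S) => //; split=> // [j|]; first exact: le_trans (jS j) Sn.
  rewrite rE -(rmorph_nat (real_complex R)) -fmorphV lecR.
  by rewrite -[leRHS]invrK lef_pV2 ?posrE ?invr_gt0 ?ltr0n// (le_trans rS).
apply: null_set_bigcup => // n.
have [|B [L [_ L0 _ hL]]] := @polyfun_lipschitz _ _ g n.+1%:R _ pg => //.
have LE : L = (re L)%:C%C by rewrite RRe_real// ger0_real.
have reL0 : 0 <= re L by rewrite -ler0c -LE.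
apply: (@null_set_lipschitz_graph _ _ _ k n.+1%:R (n.+1%:R * re L)).
- by rewrite ltr0n.
- by rewrite mulr_ge0.
- by move=> x [].
move=> x y r [xM gx sx] [yM gy _] r0 xyr.
have natC : n.+1%:R = n.+1%:R%:C%C :> C by rewrite rmorph_nat.
(* Moving x_k to y_k changes g by the slope times y_k - x_k; the remaining
   coordinates are then r-close to those of y, where g vanishes. *)
set u := upd (real_point x) k (y ord0 k)%:C%C.
have uE j : u ord0 j = (if j == k then y ord0 k else x ord0 j)%:C%C.
  by rewrite updE mxE; case: ifP.
have gu : `|g u - g (real_point y)| <= L * r%:C%C.
  apply: hL => j; rewrite ?uE ?mxE -?rmorphB norm_real_complex ?natC lecR//.
    by case: ifP.
  by case: eqVneq => [->|/xyr//]; rewrite subrr normr0.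
move: gu; rewrite gy subr0 mg gx add0r mxE -rmorphB normrM norm_real_complex.
move=> H; have {}H : `|y ord0 k - x ord0 k|%:C%C * n.+1%:R^-1 <= (re L * r)%:C%C.
  by rewrite rmorphM /= -LE; apply: (le_trans _ H); rewrite ler_wpM2l// ler0c.
move: H; rewrite natC -fmorphV -rmorphM lecR ler_pdivrMr ?ltr0n// distrC.
by move=> H; rewrite -mulrA mulrC.
Qed.

Lemma mix_upd (w z : 'rV[C]_d) (k : 'I_d) v s : mix w (upd z k v) s =
  if (k < s)%N then mix w z s else upd (mix w z s) k v.
Proof.
case: ifP => ks; apply/rowP => j; rewrite !mxE; case: (eqVneq j k) => [->|//].
  by rewrite ks.
by rewrite ks.
Qed.

Lemma polyfun_mix (w : 'rV[C]_d) s f : polyfun f ->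
  polyfun (fun z => f (mix w z s)).
Proof.
elim=> [c|l|f1 f2 _ p1 _ p2|f1 f2 _ p1 _ p2].
- exact: polyfun_cst.
- rewrite (_ : (fun z => _) =
    if (l < s)%N then fun=> w ord0 l else fun z : 'rV[C]_d => z ord0 l).
    by case: ifP => _; [exact: polyfun_cst|exact: polyfun_coord].
  by apply/funext => z; rewrite mxE; case: ifP.
- exact: polyfunD.
- exact: polyfunM.
Qed.

Lemma maffine_mix (w : 'rV[C]_d) s f : maffine f ->
  maffine (fun z => f (mix w z s)).
Proof.
move=> mf k z v; rewrite /slope !mix_upd; case: ifP => ks.
  by rewrite subrr mulr0 addr0.
by rewrite mf [mix w z s ord0 k]mxE ks.
Qed.

(** By [pivot], applied to the walk to a real point where f is nonzero, the
    zeros are distributed over d sets to which [null_set_graph] applies. *)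
Theorem null_set_zeros (f : 'rV[C]_d -> C) (w : 'rV[R]_d) : (0 < d)%N ->
  polyfun f -> maffine f -> f (real_point w) != 0 ->
  Defs.null_set [set x : 'rV[R]_d | f (real_point x) = 0].
Proof.
move=> d_gt0 pf mf fw.
pose g (k : nat) z := f (mix (real_point w) z k).
pose A (n : nat) := [set x : 'rV[R]_d | exists k : 'I_d, nat_of_ord k = n /\
  (g k (real_point x) = 0 /\ slope k (g k) (real_point x) != 0)].
apply: (@null_set_subset _ _ _ (\bigcup_n A n)) => [x fx|].
  have [k [fk sk]] := pivot mf fx fw.
  exists k => //; exists k; split=> //; split=> //.
  by move: sk; rewrite /slope /g !mix_upd ltnn.
apply: null_set_bigcup => // n.
have [dn|nd] := leqP d n.
  apply: (@null_set_subset _ _ _ [set x : 'rV[R]_d |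
    g 0 (real_point x) = 0 /\ slope (Ordinal d_gt0) (g 0) (real_point x) != 0]).
    by move=> x [k [kn _]]; move: (ltn_ord k); rewrite kn ltnNge dn.
  by apply: null_set_graph; [exact: polyfun_mix|exact: maffine_mix].
apply: null_set_subset (@null_set_graph (g n) (Ordinal nd) _ _).
- by move=> x [k [kn H]]; rewrite (_ : Ordinal nd = k) -?kn//; apply: val_inj.
- exact: polyfun_mix.
- exact: maffine_mix.
Qed.

End ZeroSets.

(** * Polynomials of degree at most one in each variable *)

Section MultiAffinePolynomials.
Variables (K : comNzRingType) (d : nat).
Implicit Types (q : mpoly d K) (m : multinom d) (z : 'rV[K]_d) (k : 'I_d).

Definition multilinear_mnm m : Prop := forall k, (m k <= 1)%N.

Lemma degk_le1 q : (forall k, (degk k q <= 1)%N) ->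
  forall m, m \in msupp q -> multilinear_mnm m.
Proof.
move=> dq m mq k; apply: leq_trans (dq k).
exact: (@leq_bigmax_seq _ _ xpredT (fun m : multinom d => m k)).
Qed.

Definition mono (m : multinom d) z : K := \prod_i z ord0 i ^+ m i.

Lemma pevalE q z : peval z q = \sum_(m <- msupp q) mcoeff m q * mono m z.
Proof. by rewrite /peval mevalE. Qed.

Lemma polyfun_mono m : polyfun (mono m).
Proof. by apply: polyfun_prod => i; apply/polyfunX/polyfun_coord. Qed.

Lemma polyfun_peval q : polyfun (fun z => peval z q).
Proof.
rewrite (_ : (fun z => _) = fun z => \sum_(m <- msupp q) mcoeff m q * mono m z).
  by apply: polyfun_sum => m; apply: polyfunM;
    [exact: polyfun_cst|exact: polyfun_mono].
by apply/funext => z; rewrite pevalE.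
Qed.

Lemma mono_upd m z k w :
  mono m (upd z k w) = w ^+ m k * \prod_(i < d | i != k) z ord0 i ^+ m i.
Proof.
rewrite /mono (bigD1 k)//= updE eqxx; congr (_ * _).
by apply: eq_bigr => i ik; rewrite updE (negbTE ik).
Qed.

Lemma slope_mono m z k : (m k <= 1)%N ->
  slope k (mono m) z = (m k)%:R * \prod_(i < d | i != k) z ord0 i ^+ m i.
Proof.
rewrite /slope !mono_upd; case: (m k) => [|[|//]] _;
  first by rewrite !expr0 mul0r subrr.
by rewrite !expr1 mul0r subr0.
Qed.

Lemma maffine_mono m : multilinear_mnm m -> maffine (mono m).
Proof.
move=> m1 k z w; rewrite slope_mono// mono_upd -{2}[z](upd_id z k) mono_upd.
by case: (m k) (m1 k) => [|[|//]] _; rewrite ?expr0 ?expr1; ring.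
Qed.

Lemma maffine_peval q : (forall k, (degk k q <= 1)%N) ->
  maffine (fun z => peval z q).
Proof.
move=> /degk_le1 dq.
rewrite (_ : (fun z => _) = fun z => \sum_(m <- msupp q) mcoeff m q * mono m z).
  by apply: maffine_sum => m mq; apply/maffineZ/maffine_mono/dq.
by apply/funext => z; rewrite pevalE.
Qed.

Lemma peval_mderiv q k z : (forall k, (degk k q <= 1)%N) ->
  peval z (mderiv k q) = slope k (fun z => peval z q) z.
Proof.
move=> /degk_le1 dq.
have -> : slope k (fun z => peval z q) z =
    \sum_(m <- msupp q) mcoeff m q * slope k (mono m) z.
  by rewrite /slope !pevalE -sumrB; apply: eq_bigr => m _; rewrite mulrBr.
rewrite {1}[q]mpolyE linear_sum /peval raddf_sum /=.
rewrite !big_seq; apply: eq_bigr => m mq.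
rewrite mderivZ mderivX !mevalZ mevalX; congr (_ * _).
rewrite slope_mono ?dq//; case E : (m k) (dq m mq k) => [|[|//]] _;
  first by rewrite !mul0r.
congr (_ * _); rewrite (bigD1 k)//= mnmBE mnm1E eqxx E subnn expr0 mul1r.
by apply: eq_bigr => i ik; rewrite mnmBE mnm1E eq_sym (negbTE ik) subn0.
Qed.

(** Evaluate at the indicator of a monomial m of least total degree in the
    support: only monomials dividing m survive, and m is the only one. *)
Lemma peval_neq0 q : q != 0 -> (forall k, (degk k q <= 1)%N) ->
  exists w : 'I_d -> nat, peval (\row_k (w k)%:R) q != 0.
Proof.
move=> q0 /degk_le1 dq.
have exn : exists n, has (fun m : multinom d => mdeg m == n) (msupp q).
  exists (mdeg (mlead q)); apply/hasP; exists (mlead q); rewrite ?mlead_supp//.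
case: (ex_minnP exn) => n /hasP[m mq /eqP mn] min_n.
exists m; rewrite pevalE (bigD1_seq m)//= ?msupp_uniq// big1_seq ?addr0.
  rewrite /mono big1 ?mulr1 -?mcoeff_msupp// => i _; rewrite mxE.
  by case: (m i) (dq m mq i) => [|[|//]] _; rewrite ?expr0 ?expr1.
move=> m' /andP[m'm m'q].
have [i /eqP mi /eqP m'i] : exists2 i, m i == 0%N & m' i == 1%N.
  apply/exists_inP; apply: contraNT m'm => /exists_inPn H.
  have le i : (m' i <= m i)%N.
    have := H i; rewrite unfold_in /=; case: (m i) => [|k].
      by move=> /(_ isT); case: (m' i) (dq m' m'q i) => [|[|]].
    by move=> _; apply: leq_trans (dq m' m'q i) _.
  have : (mdeg m <= mdeg m')%N.
    by rewrite mn; apply: min_n; apply/hasP; exists m'.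
  have sle : (\sum_i m' i <= \sum_i m i)%N by apply: leq_sum => i _; exact: le.
  rewrite !mdegE => sge; have e : (\sum_i m i = \sum_i m' i)%N.
    by apply/eqP; rewrite eqn_leq sge sle.
  apply/eqP/mnmP => i; apply/eqP; apply: contraT => ne.
  have lt : (m' i < m i)%N by rewrite ltn_neqAle ne le.
  have : (\sum_i m' i < \sum_i m i)%N.
    rewrite (bigD1 i)//= [ltnRHS](bigD1 i)//= -addSn; apply: leq_add => //.
    by apply: leq_sum => l _; exact: le.
  by rewrite e ltnn.
by rewrite /mono (bigD1 i)//= mxE mi m'i expr1 mul0r mulr0.
Qed.

End MultiAffinePolynomials.

(** * The rational function in the Pick class *)

Section Holomorphy.
Variables (K : numFieldType) (d m : nat).

Lemma polyfun_differentiable (f : 'rV[K]_d -> K) z :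
  polyfun f -> differentiable f z.
Proof.
elim=> [c|k|f1 f2 _ d1 _ d2|f1 f2 _ d1 _ d2].
- exact: differentiable_cst.
- exact: differentiable_coord.
- exact: differentiableD.
- exact: differentiableM.
Qed.

Lemma holomorphic_quotient (P : 'rV[K]_d -> 'M[K]_m) (q : 'rV[K]_d -> K) z :
  (forall i j, polyfun (fun z => P z i j)) -> polyfun q -> q z != 0 ->
  holomorphic_at (fun z => (q z)^-1 *: P z) z.
Proof.
move=> pP pq qz; rewrite /holomorphic_at.
have -> : (fun z => (q z)^-1 *: P z) =
    \sum_(i < m) \sum_(j < m) (fun z => ((q z)^-1 * P z i j) *: delta_mx i j).
  apply/funext => y; rewrite [LHS]matrix_sum_delta !fct_sumE.
  apply: eq_bigr => i _; rewrite fct_sumE; apply: eq_bigr => j _.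
  by rewrite mxE.
apply: differentiable_sum => i; apply: differentiable_sum => j.
apply: differentiableZl; apply: differentiableM.
  by apply: differentiableV => //; exact: polyfun_differentiable.
exact: polyfun_differentiable.
Qed.

End Holomorphy.

Section HermitianMatrices.
Variables (K : numClosedFieldType) (m : nat).
Local Open Scope sesquilinear_scope.
Implicit Types (A : 'M[K]_m).

Lemma hermsymmxP A : reflect (A ^t* = A) (A \is hermsymmx).
Proof.
apply: (iffP (is_hermitianmxP _ _ _)); rewrite expr0 scale1r; exact: esym.
Qed.

Lemma form_hermsymmx_real v A : A \is hermsymmx -> form v A \is Num.real.
Proof. by move=> /hermsymmxP hA; apply/CrealP; rewrite -form_adj hA. Qed.

Lemma hermsymmxB A B : A \is hermsymmx -> B \is hermsymmx -> A - B \is hermsymmx.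
Proof.
move=> /hermsymmxP hA /hermsymmxP hB; apply/hermsymmxP.
by rewrite -{2}hA -{2}hB; apply/matrixP => i j; rewrite !mxE rmorphB.
Qed.

Lemma hermsymmxZ c A : c \is Num.real -> A \is hermsymmx -> c *: A \is hermsymmx.
Proof.
move=> /CrealP hc /hermsymmxP hA; apply/hermsymmxP.
by rewrite -{2}hA; apply/matrixP => i j; rewrite !mxE rmorphM; congr (_ * _).
Qed.

Lemma form_mxIm v A : form v (mxIm A) = 'Im (form v A).
Proof.
rewrite /mxIm formZ formB form_adj ImE invfM invCi.
by rewrite mulrN mulNr -mulrN opprB mulrC mulrA (mulrC _ 'i) mulrA.
Qed.

Lemma mxIm_hermsymmx A : mxIm A \is hermsymmx.
Proof.
apply/hermsymmxP; rewrite /mxIm; apply/matrixP => i j; rewrite !mxE.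
rewrite rmorphM fmorphV rmorphM rmorphB rmorph_nat /= conjCi /= conjCK.
by rewrite mulrN invrN mulNr -mulrN opprB.
Qed.

End HermitianMatrices.

Section WronskianCriterion.
Variables (R : realType) (d m : nat) (P : 'M[mpoly d (complex R)]_m)
  (q : mpoly d (complex R)).
Local Notation C := (complex R).
Local Notation Pf := (fun z => mxeval z P).
Local Notation qf := (fun z => peval z q).

Hypothesis Pdeg : forall i j k, (degk k (P i j) <= 1)%N.
Hypothesis qdeg : forall k, (degk k q <= 1)%N.
Hypothesis q_real : real_poly q.
Hypothesis P_herm : hermitian_poly P.

Lemma real_ptE (z : 'rV[C]_d) : real_pt z ->
  z = real_point (map_mx (@complex.Re R) z).
Proof.
move=> rz; apply/rowP => j; rewrite !mxE; apply/eqP.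
by rewrite eq_complex /= rz !eqxx.
Qed.

Lemma real_pt_real_point (x : 'rV[R]_d) : real_pt (real_point x).
Proof. by move=> j; rewrite mxE. Qed.

Lemma form_mxeval v (z : 'rV[C]_d) : form v (mxeval z P) =
  \sum_j \sum_i ((v i ord0)^* * v j ord0) * peval z (P i j).
Proof.
rewrite form_sum; apply: eq_bigr => j _; apply: eq_bigr => i _.
by rewrite mxE.
Qed.

Lemma slope_form v k (z : 'rV[C]_d) : slope k (fun z => form v (mxeval z P)) z =
  form v (map_mx (fun p => slope k (fun z => peval z p) z) P).
Proof.
rewrite /slope -formB; congr form; apply/matrixP => i j; by rewrite !mxE.
Qed.

Lemma wronsk_form v k (z : 'rV[C]_d) :
  wronsk k (fun z => form v (mxeval z P)) qf z =
  form v (mxeval z (wronskian k q P)).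
Proof.
rewrite /wronsk slope_form -formZ mulrC -formZ -formB; congr form.
apply/matrixP => i j; rewrite !mxE /peval mevalB !mevalM.
by rewrite -!/(peval _ _) !peval_mderiv.
Qed.

(** Partial derivatives are differences of values at real points, hence
    Hermitian too. *)
Lemma mxeval_wronskian_herm k (x : 'rV[R]_d) :
  mxeval (real_point x) (wronskian k q P) \is hermsymmx.
Proof.
have up (w : R) : upd (real_point x) k w%:C%C = real_point (upd x k w).
  by apply/rowP => j; rewrite !(updE, mxE); case: ifP.
have up0 : upd (real_point x) k 0 = real_point (upd x k 0) by rewrite -up rmorph0.
have up1 : upd (real_point x) k 1 = real_point (upd x k 1) by rewrite -up rmorph1.
have -> : mxeval (real_point x) (wronskian k q P) =
    qf (real_point x) *: (Pf (real_point (upd x k 1)) - Pf (real_point (upd x k 0)))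
    - slope k qf (real_point x) *: Pf (real_point x).
  apply/matrixP => i j; rewrite !mxE /peval mevalB !mevalM -!/(peval _ _).
  by rewrite !peval_mderiv// {1}/slope up0 up1.
apply: hermsymmxB; first by apply: hermsymmxZ => //; exact: hermsymmxB.
by apply: hermsymmxZ => //; rewrite /slope up0 up1 rpredB.
Qed.

Lemma maffine_form v : maffine (fun z => form v (mxeval z P)).
Proof.
rewrite (_ : (fun z => _) = fun z =>
  \sum_j \sum_i ((v i ord0)^* * v j ord0) * peval z (P i j)).
  apply: maffine_sum => j _; apply: maffine_sum => i _.
  exact/maffineZ/maffine_peval.
by apply/funext => z; rewrite form_mxeval.
Qed.

Lemma polyfun_form v : polyfun (fun z => form v (mxeval z P)).
Proof.
rewrite (_ : (fun z => _) = fun z =>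
  \sum_j \sum_i ((v i ord0)^* * v j ord0) * peval z (P i j)).
  apply: polyfun_sum => j; apply: polyfun_sum => i.
  by apply: polyfunM; [exact: polyfun_cst|exact: polyfun_peval].
by apply/funext => z; rewrite form_mxeval.
Qed.

Lemma real_im0 (c : C) : c \is Num.real -> im c = 0.
Proof. by move=> /complex_realP[k ->]. Qed.

Lemma real_fun_form v : real_fun (fun z => form v (mxeval z P)).
Proof.
by move=> z rz; apply/real_im0/form_hermsymmx_real; rewrite (real_ptE rz);
  exact: P_herm.
Qed.

Lemma real_fun_peval : real_fun qf.
Proof. by move=> z rz; apply: real_im0; rewrite (real_ptE rz); exact: q_real. Qed.

Lemma psd_increasing_mx : (forall k, psd_poly (wronskian k q P)) ->
  increasing_mx Pf qf.
Proof.
move=> W; split=> [i j|v].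
  rewrite (_ : (fun z => _) = fun z => peval z (P i j)); first exact: polyfun_peval.
  by apply/funext => z; rewrite mxE.
split.
- exact: polyfun_form.
- exact: polyfun_peval.
- exact: maffine_form.
- exact: maffine_peval.
- exact: real_fun_form.
- exact: real_fun_peval.
move=> k x rx; rewrite wronsk_form (real_ptE rx).
have [_ /(_ v)] := W k (map_mx (@complex.Re R) x).
by rewrite -/(form v _) lecE => /andP[].
Qed.

Lemma upperP (z : 'rV[C]_d) : upper_polyhalfplane z <-> upper z.
Proof.
by split=> h k; have := h k; rewrite -complexIm -(rmorph0 (real_complex R)) ltcR.
Qed.

(** Im (a / c) = cross a c / |c|^2. *)
Lemma psd_mxIm_quotient (c : C) (A : 'M[C]_m) : c != 0 ->
  (forall v, 0 <= cross (form v A) c) <-> psdmx (mxIm (c^-1 *: A)).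
Proof.
move=> c0.
have E v : form v (mxIm (c^-1 *: A)) =
    ((re c ^+ 2 + im c ^+ 2)^-1 * cross (form v A) c)%:C%C.
  rewrite form_mxIm formZ -complexIm; congr (_%:C%C).
  apply: (mulfI (lt0r_neq0 (normsq_gt0 c0))); rewrite mulrA.
  rewrite divff ?mul1r; last first.
    exact/lt0r_neq0/normsq_gt0.
  have e : form v A = c * (c^-1 * form v A) by rewrite mulrA divff ?mul1r.
  rewrite {2}e -[c in cross _ c]mulr1 crossMl /cross /= !mulr1 mulr0 subr0.
  by [].
have nc : 0 < (re c ^+ 2 + im c ^+ 2)^-1 by rewrite invr_gt0 normsq_gt0.
split=> [h|[_ h] v].
  split=> [|v]; first exact: mxIm_hermsymmx.
  by rewrite -/(form v _) E ler0c mulr_ge0// ltW.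
by have := h v; rewrite -/(form v _) E ler0c pmulr_rge0.
Qed.

Lemma cayley_inner_of_increasing : (0 < d)%N -> q != 0 ->
  increasing_mx Pf qf -> cayley_inner P q.
Proof.
move=> d_gt0 q0 incr; have [w0 qw0] := peval_neq0 q0 qdeg.
split; last first.
  apply: (@null_set_subset _ _ _ [set x : 'rV[R]_d | qf (real_point x) = 0]).
    move=> x /= H; apply/eqP; apply: contraT => qx; case: H; split=> //.
    by apply: hermsymmxZ; [rewrite rpredV; exact: q_real|exact: P_herm].
  apply: (@null_set_zeros R d qf (\row_k (w0 k)%:R)) => //.
  - exact: polyfun_peval.
  - exact: maffine_peval.
  have -> // : real_point (\row_k (w0 k)%:R) = \row_k (w0 k)%:R :> 'rV[C]_d.
  by apply/rowP => j; rewrite !mxE rmorph_nat.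
have [|P' [q' [incr' rel q'n0]]] := cancel_upper_zeros incr.
  by exists (\row_k (w0 k)%:R).
exists (fun z => (q' z)^-1 *: P' z); first split=> z /upperP uz.
- apply: holomorphic_quotient; last exact: q'n0.
    exact: (incm_poly incr').
  exact: (inc_polyr (incm_form incr' 0)).
- apply/(psd_mxIm_quotient _ (q'n0 z uz)) => v.
  by apply: (increasing_cross_ge0 (incm_form incr' v)) => k; exact: ltW.
move=> z /upperP uz qz.
apply: (scalerI (q'n0 z uz)); apply: (scalerI qz).
rewrite [q' z *: _]scalerA divff ?q'n0// scale1r rel.
by rewrite !scalerA mulrAC divff// mul1r.
Qed.

(** The point x + i e_k is the limit of the points x + i e_k + i t (1, ..., 1)
    of the polyhalfplane, along which cross is a polynomial in t. *)
Lemma wronsk_ge0_of_cross_ge0 (f g : 'rV[C]_d -> C) k x :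
  polyfun f -> polyfun g -> maffine f -> maffine g -> real_fun f -> real_fun g ->
  (forall z, upper z -> 0 <= cross (f z) (g z)) ->
  real_pt x -> 0 <= re (wronsk k f g x).
Proof.
move=> pf pg mf mg rf rg H rx.
pose u := upd x k (x ord0 k + 'i%C); pose v : 'rV[C]_d := \row_j 'i%C.
have [s hs] := polyfun_line_cross u v pf pg.
have s0 : 0 <= s.[0].
  rewrite leNgt; apply/negP => s0.
  have [|e e0 he] := @poly_pos_near0 R unit [:: tt] (fun=> - s).
    by move=> _; rewrite hornerN oppr_gt0.
  have e2 : 0 < e / 2 by rewrite divr_gt0.
  have : 0 <= s.[e / 2].
    rewrite hs; apply: H => j; rewrite !mxE.
    by case: ifP => _; rewrite !reimE /= rx; lra.
  have te : 0 <= e / 2 < e by apply/andP; split; lra.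
  by have /andP[] := he _ te; rewrite hornerN oppr_gt0 ltNge => /negP.
move: s0; rewrite hs rmorph0 scale0r addr0 /u mf mg (addrC (x _ _)) addrK.
rewrite /wronsk.
move: (rf x rx) (rg x rx) (real_fun_slope k rf rx) (real_fun_slope k rg rx).
case: (f x) => a a'; case: (g x) => c c' /= -> ->.
case: (slope k f x) => b b'; case: (slope k g x) => e e' /= -> ->.
rewrite /cross !reimE /= => h; apply: (le_trans h); rewrite le_eqVlt.
by apply/orP; left; apply/eqP; ring.
Qed.

Lemma psd_of_cayley_inner : cayley_inner P q ->
  forall k, psd_poly (wronskian k q P).
Proof.
move=> [[F [_ psdF] FE] _] k x; split; first exact: mxeval_wronskian_herm.
move=> v; rewrite -/(form v _) -wronsk_form.
set W := wronsk _ _ _ _.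
have Wreal : W \is Num.real.
  by rewrite /W wronsk_form; apply/form_hermsymmx_real/mxeval_wronskian_herm.
rewrite -(RRe_real Wreal) ler0c; apply: wronsk_ge0_of_cross_ge0.
- exact: polyfun_form.
- exact: polyfun_peval.
- exact: maffine_form.
- exact: maffine_peval.
- exact: real_fun_form.
- exact: real_fun_peval.
- move=> z /upperP uz; have [qz|qz] := eqVneq (peval z q) 0.
    by rewrite qz /cross /= !mulr0 subrr.
  have := psdF z uz; rewrite FE// => psd_z.
  exact: (psd_mxIm_quotient _ qz).2.
- exact: real_pt_real_point.
Qed.

End WronskianCriterion.

Theorem theorem3p2 (R : realType) (d m : nat) (d_gt0 : (0 < d)%N)
    (m_gt0 : (0 < m)%N) (P : 'M[mpoly d (complex R)]_m)
    (q : mpoly d (complex R)) (q_neq0 : q != 0)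
    (q_real : real_poly q) (P_herm : hermitian_poly P)
    (Pq_multi_affine : multi_affine P q) :
  cayley_inner P q <-> (forall k : 'I_d, psd_poly (wronskian k q P)).
Proof.
have qdeg k : (degk k q <= 1)%N by rewrite -(Pq_multi_affine k) leq_maxr.
have Pdeg i j k : (degk k (P i j) <= 1)%N.
  rewrite -(Pq_multi_affine k) leq_max; apply/orP; left.
  apply: (leq_trans _ (leq_bigmax i)).
  exact: (leq_bigmax (F := fun j => degk k (P i j)) j).
split=> [|W]; first exact: psd_of_cayley_inner.
by apply: cayley_inner_of_increasing => //; exact: psd_increasing_mx.
Qed.
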